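(* Let $\mathbf K$ be $\mathbf H$ or $\mathbf O$. Let $U_1$ and $U_2$ be two Jordan domains in $\mathbf K$, where for $j=1,2$ the boundary $\partial U_j$ contains a domain $V_j$ in a hyperplane or in a hypersphere over $\mathbf R$ in $\mathbf K$. Suppose that $W_1$ and $W_2$ are Jordan domains symmetrical with $U_1$ and $U_2$ relative to $V_1$ and $V_2$ respectively, where $U_j\cap W_j=\emptyset$ for $j=1,2$. If a function $f_1$ maps $U_1$ on $U_2$ pseudoconformally, where $f_1(V_1)=V_2$, and there exists the limit $$\lim_{z\to\zeta}\partial f_1(z)/\partial z\neq0\quad\text{for each }\zeta\in V_1,$$ then $f_1$ has a pseudoconformal extension $f$ on $W_1$, and $f$ maps $U_1\cup V_1\cup W_1$ on $U_2\cup V_2\cup W_2$.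
   Context: $\mathbf K$ is the quaternion skew field $\mathbf H$ ($r=2$) or the octonion algebra $\mathbf O$ ($r=3$); $\tilde z=z^*$ is the conjugate, $|z|^2=z\tilde z$, $\mathrm{Re}(z)=(z+\tilde z)/2$. Functions of $z$ are represented by phrases (finite or convergent infinite sums of bracketed words in $z$, $\tilde z$ and constants of $\mathbf K$); $\partial f/\partial z$ and $\partial f/\partial\tilde z$ are the partial (super)derivatives, $\mathbf R$-linear operators whose sum is the Fréchet derivative. A differentiable $f:U\to\mathbf K$ is pseudoconformal at $\xi\in U$ if (1) $\partial f(z)/\partial\tilde z=0$ at $z=\xi$; (2) writing $f'(\xi)=(\partial f/\partial z)|_{z=\xi}$, $\mathrm{Re}\{[f'(\xi).h_1][f'(\xi).h_2]^*\}|h_1||h_2|=|f'(\xi).h_1||f'(\xi).h_2|\,\mathrm{Re}(h_1\tilde h_2)$ for all $h_1,h_2\in\mathbf K$; (3) $f'(\xi)\neq0$; where nonproper rotations of the underlying space $\mathbf R^{2^r}$ associated with $f'$ are excluded. $f$ is pseudoconformal on $U$ if it is so at each point of $U$. Jordan domains. A surface $V$ of real dimension $m$ in $\mathbf K$ parametrized as $V=\gamma([0,1]^m)$ is a Jordan surface if $\gamma$ is bijective from $[0,1]^m$ onto $V$. A Jordan domain in $\mathbf K$ is an open domain whose boundary is the union of finitely many Jordan hypersurfaces (real dimension $2^r-1$) with pairwise intersections of real dimension at most $2^r-2$. Symmetry. Points $z_1,z_2$ are symmetrical relative to a hypersphere with centre $z_0$ and radius $R>0$ if $|z_1-z_0||z_2-z_0|=R^2$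 and $\mathrm{Arg}(z_2-z_0)=\mathrm{Arg}(z_1-z_0)$, where $z=|z|\exp(\mathrm{Arg}(z))$, $\mathrm{Re}(\mathrm{Arg}(z))=0$; relative to a hyperplane, if they are mirror images in it. Domains $U_j,W_j$ are symmetrical relative to $V_j$ if $W_j$ is the image of $U_j$ under the symmetry with respect to the hyperplane or hypersphere containing $V_j$. On $V_1$ the values of $f_1$ are those of its continuous extension. *)

(* Defs.v *)
(* MathComp / MathComp-Analysis *)
From HB Require Import structures.
From mathcomp Require Import all_boot all_order all_algebra.
From mathcomp Require Import all_classical all_reals all_analysis.
Set Implicit Arguments.
Unset Strict Implicit.
Unset Printing Implicit Defensive.
Import Order.TTheory GRing.Theory Num.Theory.
Import numFieldNormedType.Exports.
Local Open Scope classical_set_scope.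
Local Open Scope ring_scope.

(* An element of the n-th Cayley-Dickson algebra (n = 2: quaternions, n = 3:
   octonions) is the row vector of its coordinates, so that topology and
   R-linear structure are the standard ones of R^(2^n).  The dimension is
   defined by doubling so that the two halves of a vector are given by
   lsubmx / rsubmx without casts. *)
Fixpoint cdim (n : nat) : nat := if n is k.+1 then (cdim k + cdim k)%N else 1%N.

Lemma cdimE n : cdim n = (2 ^ n)%N.
Proof. by elim: n => //= n ->; rewrite addnn -mul2n -expnS. Qed.

Notation cd R n := 'rV[R]_(cdim n).

Section CayleyDickson.
Variable R : realType.

Definition cdl n (z : cd R n.+1) : cd R n := @lsubmx R 1 (cdim n) (cdim n) z.
Definition cdr n (z : cd R n.+1) : cd R n := @rsubmx R 1 (cdim n) (cdim n) z.
Definition cdpair n (a b : cd R n) : cd R n.+1 :=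
  @row_mx R 1 (cdim n) (cdim n) a b.

Fixpoint cdone n : cd R n :=
  if n is k.+1 then cdpair (cdone k) 0 else const_mx 1.

Fixpoint cdconj n : cd R n -> cd R n :=
  if n is k.+1 then fun z => cdpair (cdconj (cdl z)) (- cdr z) else fun z => z.

(* (a, b)(c, d) = (a c - d~ b, d a + b c~) *)
Fixpoint cdmul n : cd R n -> cd R n -> cd R n :=
  if n is k.+1 then fun x y =>
    cdpair (cdmul (cdl x) (cdl y) - cdmul (cdconj (cdr y)) (cdr x))
           (cdmul (cdr y) (cdl x) + cdmul (cdr x) (cdconj (cdl y)))
  else fun x y => \row_i (x 0 i * y 0 i).

(* The real number t such that z + z~ = 2 t. *)
Fixpoint cdre n : cd R n -> R :=
  if n is k.+1 then fun z => cdre (cdl z) else fun z => z 0 0.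

(* The Euclidean norm; the library norm `|z| on row vectors is the sup norm,
   which only serves to define the topology. *)
Definition cdabs n (z : cd R n) : R := Num.sqrt (cdre (cdmul z (cdconj z))).

Definition cdexpn n (z : cd R n) (k : nat) : cd R n :=
  iter k (cdmul z) (cdone n).

Definition cdexp n (z : cd R n) : cd R n :=
  lim (series (fun k => (k`!%:R)^-1 *: cdexpn z k) @ \oo).

(* Arg is multivalued: this is the set of its values at z. *)
Definition cdArg n (z : cd R n) : set (cd R n) :=
  [set M | cdre M = 0 /\ z = cdabs z *: cdexp M].

End CayleyDickson.

Section Phrases.
Variables (R : realType) (n : nat).
Local Notation K := (cd R n).

(* Bracketed words in z, z~ and constants. *)
Inductive word : Type :=
| WConst of K
| WVar
| WBar
| WMul of word & word.

Fixpoint weval (w : word) (z : K) : K :=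
  match w with
  | WConst c => c
  | WVar => z
  | WBar => cdconj z
  | WMul u v => cdmul (weval u z) (weval v z)
  end.

Fixpoint wdz (w : word) (z h : K) : K :=
  match w with
  | WConst _ => 0
  | WVar => h
  | WBar => 0
  | WMul u v => cdmul (wdz u z h) (weval v z) + cdmul (weval u z) (wdz v z h)
  end.

Fixpoint wdzbar (w : word) (z h : K) : K :=
  match w with
  | WConst _ => 0
  | WVar => 0
  | WBar => cdconj h
  | WMul u v =>
      cdmul (wdzbar u z h) (weval v z) + cdmul (weval u z) (wdzbar v z h)
  end.

(* Near xi, f is the sum of a phrase in z - a, (z - a)~ and constants, whose
   partial superderivatives at xi are A = df/dz and B = df/dz~ (these depend on
   the phrase, since z~ is itself a phrase in z; their sum does not, being the
   Frechet derivative of f at xi).  A phrase is a sum without a prescribed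
   order, so convergence is unconditional, that is, absolute; a finite sum is
   padded with zero constants. *)
Definition superderivatives (f : K -> K) (xi : K) (A B : K -> K) : Prop :=
  exists (a : K) (w : nat -> word),
    [/\ \forall z \near xi,
          cvg (series (fun k => cdabs (weval (w k) (z - a))) @ \oo) /\
          series (fun k => weval (w k) (z - a)) @ \oo --> f z,
        forall h, series (fun k => wdz (w k) (xi - a) h) @ \oo --> A h &
        forall h, series (fun k => wdzbar (w k) (xi - a) h) @ \oo --> B h].

(* f is pseudoconformal at xi, with f'(xi) = A.  The determinant condition
   excludes nonproper rotations. *)
Definition pseudoconformal_at (f : K -> K) (xi : K) (A : K -> K) : Prop :=
  [/\ superderivatives f xi A (fun=> 0),
      forall h1 h2 : K,
        cdre (cdmul (A h1) (cdconj (A h2))) * cdabs h1 * cdabs h2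
        = cdabs (A h1) * cdabs (A h2) * cdre (cdmul h1 (cdconj h2)),
      exists h, A h != 0 &
      0 < \det (lin1_mx A)].

Definition pseudoconformal_on (f : K -> K) (D : K -> K -> K) (U : set K) :=
  forall xi, U xi -> pseudoconformal_at f xi (D xi).

End Phrases.

(* Lebesgue covering dimension of A (as a subspace of T) is at most k. *)
Definition covdim_le (T : topologicalType) (k : nat) (A : set T) : Prop :=
  forall (p : nat) (U : 'I_p -> set T),
    (forall i, open (U i)) -> A `<=` \bigcup_(i in setT) U i ->
  exists (q : nat) (V : 'I_q -> set T),
    [/\ forall j, open (V j),
        A `<=` \bigcup_(j in setT) V j,
        forall j, exists i, A `&` V j `<=` U i &
        forall x, A x -> (#|[set j | `[< V j x >]]%SET| <= k.+1)%N].

Section Geometry.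
Variables (R : realType) (n : nat).
Local Notation K := (cd R n).

Definition unit_cube (m : nat) : set 'rV[R]_m :=
  [set t | forall i, 0 <= t 0 i <= 1].
Arguments unit_cube : clear implicits.

Definition Jordan_surface (m : nat) (V : set K) : Prop :=
  exists g : 'rV[R]_m -> K,
    [/\ {within unit_cube m, continuous g},
        set_inj (unit_cube m) g &
        V = g @` unit_cube m].

Definition frontier (U : set K) : set K := closure U `\` interior U.

Definition Jordan_domain (U : set K) : Prop :=
  [/\ open U, connected U, U !=set0 &
      exists (p : nat) (S : 'I_p -> set K),
        [/\ frontier U = \bigcup_(i in setT) S i,
            forall i, Jordan_surface (2 ^ n).-1 (S i) &
            forall i j, i != j -> covdim_le (2 ^ n).-2 (S i `&` S j)]].

(* Hyperplane b c is {z | Re (z b~) = c}; Hypersphere z0 r is {z | |z - z0| = r}. *)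
Inductive mirror : Type :=
| Hyperplane of K & R
| Hypersphere of K & R.

Definition mirror_ok (S : mirror) : Prop :=
  match S with
  | Hyperplane b _ => b != 0
  | Hypersphere _ r => 0 < r
  end.

Definition mirror_set (S : mirror) : set K :=
  match S with
  | Hyperplane b c => [set z | cdre (cdmul z (cdconj b)) = c]
  | Hypersphere z0 r => [set z | cdabs (z - z0) = r]
  end.

(* For a hyperplane: z2 - z1 is normal to it and the midpoint lies in it. *)
Definition symmetrical (S : mirror) (z1 z2 : K) : Prop :=
  match S with
  | Hyperplane b c =>
      (exists t : R, z2 - z1 = t *: b) /\
      mirror_set (Hyperplane b c) (2^-1 *: (z1 + z2))
  | Hypersphere z0 r =>
      cdabs (z1 - z0) * cdabs (z2 - z0) = r ^+ 2 /\
      cdArg (z2 - z0) = cdArg (z1 - z0)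
  end.

(* A domain in the hyperplane or hypersphere S. *)
Definition domain_in (S : mirror) (V : set K) : Prop :=
  [/\ exists2 O : set K, open O & V = O `&` mirror_set S,
      connected V & V !=set0].

(* W is the image of U under the symmetry.  The symmetry has to be defined on
   all of U: the centre of a hypersphere has no symmetrical point in K, so it
   cannot belong to U. *)
Definition symmetrical_domains (S : mirror) (U W : set K) : Prop :=
  (forall u, U u -> exists2 w, W w & symmetrical S u w) /\
  (forall w, W w -> exists2 u, U u & symmetrical S u w).

End Geometry.

(* Main.v *)
(* Words have no sums and the norm of K is multiplicative, so a phrase is
   dominated by a convergent power series in |z - a|; hence f1 is real analytic
   and its derivative D1 is a similarity of determinant > 0.  By Liouville's
   theorem in dimension > 2, f1 is a Moebius map on U1: with <f1' h, f1' k> =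
   rho^-2 <h, k>, the second and third derivatives give Hess rho = s I with s
   constant and |grad rho|^2 = 2 s rho, and then f1 is affine if s = 0 and
   q + L (z - p) / |z - p|^2 otherwise.  This Moebius map is the extension: the
   pole is not in V1, where f1 has finite limits.  It maps the mirror containing
   V1 to the one containing V2, as it does so on V1, hence it is equivariant for
   the two reflections; since U2 does not contain the centre of S2, the pole is
   not in W1 either and W1 is mapped onto W2.  Finally Moebius maps have a phrase
   without z~ at every point, the inverse being a geometric series. *)
Require Import Defs.
From HB Require Import structures.
From mathcomp Require Import all_boot all_order all_algebra.
From mathcomp Require Import all_classical all_reals all_analysis.
From mathcomp Require Import ring lra.
Set Implicit Arguments.
Unset Strict Implicit.
Unset Printing Implicit Defensive.
Import Order.TTheory GRing.Theory Num.Theory.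
Import numFieldNormedType.Exports.
Local Open Scope classical_set_scope.
Local Open Scope ring_scope.

(** * The Euclidean inner product and directional derivatives *)

(** Hyperplanes and hyperspheres are treated together as zero sets of
    [alpha |x|^2 + 2 <beta, x> + gamma] with [|beta|^2 - alpha gamma > 0]. Similarities and
    inversion preserve this family (a sphere may become a hyperplane and conversely), and the
    reflection has a single formula in it, so equivariance is a rational identity without case
    distinction on the shape of a mirror or of its preimage. The second mirror is pulled back
    instead of the first one being pushed forward: the pullback is an explicit polynomial that
    vanishes on [V1], and [V1] is open in the first mirror, which fixes the equation up to a factor.
    A nonzero normal vector encodes that a point is not the centre of its mirror; if this holds at a
    point and at its image, the reflected point is off the pole. Inversion reverses orientation, so
    the sign of [\det M], read at one point of [U1], decides orientation everywhere off the pole. As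
    the octonions are not associative, the product identities are drawn from the multiplicativity of
    the norm by polarisation and adjunction. *)

Section Dot.
Variables (R : realType) (N : nat).
Implicit Types (x y z : 'rV[R]_N) (a : R).

Definition dot x y : R := \sum_i x 0 i * y 0 i.

Lemma dotC x y : dot x y = dot y x.
Proof. by apply: eq_bigr => i _; rewrite mulrC. Qed.

Lemma dotDl x y z : dot (x + y) z = dot x z + dot y z.
Proof. by rewrite /dot -big_split; apply: eq_bigr => i _; rewrite mxE mulrDl. Qed.

Lemma dotZl a x y : dot (a *: x) y = a * dot x y.
Proof. by rewrite /dot mulr_sumr; apply: eq_bigr => i _; rewrite mxE mulrA. Qed.

Lemma dotNl x y : dot (- x) y = - dot x y.
Proof. by rewrite -scaleN1r dotZl mulN1r. Qed.

Lemma dotBl x y z : dot (x - y) z = dot x z - dot y z.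
Proof. by rewrite dotDl dotNl. Qed.

Lemma dot0l x : dot 0 x = 0.
Proof. by rewrite -(scale0r 0) dotZl mul0r. Qed.

Lemma dotDr x y z : dot z (x + y) = dot z x + dot z y.
Proof. by rewrite !(dotC z) dotDl. Qed.

Lemma dotZr a x y : dot x (a *: y) = a * dot x y.
Proof. by rewrite !(dotC x) dotZl. Qed.

Lemma dotNr x y : dot x (- y) = - dot x y.
Proof. by rewrite !(dotC x) dotNl. Qed.

Lemma dotBr x y z : dot z (x - y) = dot z x - dot z y.
Proof. by rewrite !(dotC z) dotBl. Qed.

Lemma dot0r x : dot x 0 = 0.
Proof. by rewrite dotC dot0l. Qed.

Lemma dot_suml (I : Type) (s : seq I) (P : pred I) (F : I -> 'rV[R]_N) y :
  dot (\sum_(i <- s | P i) F i) y = \sum_(i <- s | P i) dot (F i) y.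
Proof. by apply: (big_morph (dot^~ y)) => [u v|]; rewrite ?dotDl ?dot0l. Qed.

Lemma dot_ge0 x : 0 <= dot x x.
Proof. by apply: sumr_ge0 => i _; rewrite -expr2 sqr_ge0. Qed.

Lemma dot_eq0 x : (dot x x == 0) = (x == 0).
Proof.
apply/eqP/eqP => [|->]; last exact: dot0l.
move/psumr_eq0P => h; apply/rowP => i; rewrite mxE; apply/eqP.
have := h (fun j _ => _) i isT; rewrite -expr2 => h2.
by rewrite -sqrf_eq0 h2// => j; rewrite -expr2 sqr_ge0.
Qed.

Lemma dot_gt0 x : (0 < dot x x) = (x != 0).
Proof. by rewrite lt0r dot_eq0 dot_ge0 andbT. Qed.

Definition ev (i : 'I_N) : 'rV[R]_N := delta_mx 0 i.

Lemma dot_evr x i : dot x (ev i) = x 0 i.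
Proof.
rewrite /dot (bigD1 i)//= big1 => [|j ji]; first by rewrite mxE !eqxx mulr1 addr0.
by rewrite mxE (negbTE ji) mulr0.
Qed.

Lemma dot_evl x i : dot (ev i) x = x 0 i.
Proof. by rewrite dotC dot_evr. Qed.

Lemma sum_ev x : x = \sum_i x 0 i *: ev i.
Proof. exact: row_sum_delta. Qed.

Lemma dotP x y : (forall z, dot x z = dot y z) -> x = y.
Proof. by move=> h; apply/rowP => i; rewrite -!dot_evr h. Qed.

Lemma cauchy_dot x y : dot x y ^+ 2 <= dot x x * dot y y.
Proof.
have [->|y0] := eqVneq y 0; first by rewrite !dot0r mulr0 expr0n.
have yp : 0 < dot y y by rewrite dot_gt0.
have := dot_ge0 (dot y y *: x - dot x y *: y).
rewrite !(dotBl, dotBr, dotZl, dotZr) (dotC y x) => h.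
have {h} : 0 <= dot y y * (dot x x * dot y y - dot x y ^+ 2) by lra.
by rewrite pmulr_rge0// subr_ge0.
Qed.

Lemma dot_mulmx x y (A : 'M[R]_N) : dot (x *m A) y = dot x (y *m A^T).
Proof.
have dE u v : dot u v = (u *m v^T) 0 0.
  by rewrite mxE; apply: eq_bigr => i _; rewrite mxE.
by rewrite !dE trmx_mul trmxK mulmxA.
Qed.

End Dot.

Definition dotE := (dotDl, dotDr, dotZl, dotZr, dotNl, dotNr).

Section Derive.
Variables (R : realType) (N : nat).
Notation V := 'rV[R]_N.

Lemma is_derive_coord m (F : V -> 'rV[R]_m) x v (d : 'rV[R]_m) i :
  is_derive x v F d -> is_derive x v (fun y => F y 0 i) (d 0 i).
Proof.
move=> [Fd <-]; have /derivable_mxP/(_ 0 i) h := Fd.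
by rewrite derive_mx// mxE; exact/derivableP.
Qed.

Lemma coord_is_derive m (F : V -> 'rV[R]_m) x v (d : 'rV[R]_m) :
  (forall i, is_derive x v (fun y => F y 0 i) (d 0 i)) -> is_derive x v F d.
Proof.
move=> h; have hd : derivable F x v.
  by apply/derivable_mxP => i j; rewrite (ord1 i); case: (h j).
split=> //; rewrite derive_mx//; apply/rowP => i; rewrite mxE.
by apply: derive_val.
Qed.

Lemma is_derive_scale (a : V -> R) m (F : V -> 'rV[R]_m) x v da (dF : 'rV[R]_m) :
  is_derive x v a da -> is_derive x v F dF ->
  is_derive x v (fun y => a y *: F y) (da *: F x + a x *: dF).
Proof.
move=> ha hF; apply: coord_is_derive => i.
have hFi := is_derive_coord i hF.
have -> : (fun y => (a y *: F y) 0 i) = a * (fun y => F y 0 i).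
  by apply/funext => y; rewrite mxE.
apply: is_derive_eq (is_deriveM ha hFi) _.
by rewrite !mxE addrC; congr (_ + _); exact: mulrC.
Qed.

Lemma is_derive_dot m (F G : V -> 'rV[R]_m) x v (dF dG : 'rV[R]_m) :
  is_derive x v F dF -> is_derive x v G dG ->
  is_derive x v (fun y => dot (F y) (G y)) (dot dF (G x) + dot (F x) dG).
Proof.
move=> hF hG.
have -> : (fun y => dot (F y) (G y)) =
  \sum_i ((fun y => F y 0 i) * (fun y => G y 0 i)).
  by apply/funext => y; rewrite fct_sumE.
rewrite /dot -big_split /=.
apply: is_derive_sum => i.
have hFi := is_derive_coord i hF; have hGi := is_derive_coord i hG.
apply: is_derive_eq (is_deriveM hFi hGi) _.
by rewrite addrC; congr (_ + _); exact: mulrC.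
Qed.

Lemma is_derive_invr (F : V -> R) x v d : F x != 0 -> is_derive x v F d ->
  is_derive x v (fun y => (F y)^-1) (- (F x) ^- 2 *: d).
Proof.
move=> F0 [Fd <-]; rewrite -deriveV//; apply/derivableP; exact: derivableV.
Qed.

Lemma is_derive_unique (W : normedModType R) (F : V -> W) x v d d' :
  is_derive x v F d -> is_derive x v F d' -> d = d'.
Proof. by case=> _ <- [_ <-]. Qed.

End Derive.

Section Constant.
Variables (R : realType) (N : nat).
Notation V := 'rV[R]_N.

(** The two difference quotients are the same function of [h]. This gives access to the chain rule
    and the mean value theorem in one real variable. *)
Lemma is_derive_line (W : normedModType R) (F : V -> W) (x v : V) (t : R) d :
  is_derive (x + t *: v) v F d <-> is_derive t 1 (fun s : R => F (x + s *: v)) d.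
Proof.
have E : (fun h : R => h^-1 *: ((F \o shift (x + t *: v)) (h *: v) - F (x + t *: v)))
  = (fun h : R => h^-1 *: (((fun s : R => F (x + s *: v)) \o shift t) (h *: 1) - F (x + t *: v))).
  apply/funext => h /=; congr (_ *: (F _ - _)).
  by rewrite scalerDl addrCA; congr (_ + (_ + _)); rewrite /GRing.scale /= mulr1.
by split=> -[hF <-]; split; move: hF; rewrite /derivable /derive E.
Qed.

Lemma is_derive_comp1 (phi : R -> R) (g : V -> R) (x v : V) a b :
  is_derive (g x) 1 phi a -> is_derive x v g b ->
  is_derive x v (phi \o g) (a * b).
Proof.
rewrite -{1 2}[x]addr0 -(scale0r v) => hphi /is_derive_line hg.
rewrite -{1}[x]addr0 -(scale0r v); apply/is_derive_line.
exact: is_derive1_comp hphi hg.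
Qed.

Lemma segment_constant (F : V -> R) (x v : V) :
  (forall t : R, 0 <= t <= 1 -> is_derive (x + t *: v) v F 0) -> F (x + v) = F x.
Proof.
move=> h.
have hd (t : R) : 0 <= t <= 1 -> is_derive t 1 (fun s : R => F (x + s *: v)) 0.
  by move=> /h /is_derive_line.
have [||c _] := @MVT_segment R (fun s : R => F (x + s *: v)) (fun=> 0) 0 1 ler01.
- move=> t; rewrite in_itv /= => /andP[t0 t1]; apply: hd.
  by rewrite (ltW t0) (ltW t1).
- apply: derivable_within_continuous => t; rewrite in_itv /= => ht.
  by case: (hd t ht).
by rewrite mul0r scale1r scale0r addr0 => /eqP; rewrite subr_eq0 => /eqP.
Qed.

(** The set where [F] takes the value [F x] is open in [U], since [F] is constant along segments
    inside a ball, and so is its complement in [U]. *)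
Lemma open_connected_constantR (U : set V) (F : V -> R) :
  open U -> connected U ->
  (forall x h, U x -> is_derive x h F 0) ->
  forall x y, U x -> U y -> F y = F x.
Proof.
move=> oU cU hF x y Ux Uy.
have near_eq z : U z -> \forall w \near z, U w /\ F w = F z.
  move=> Uz; have /nbhs_ballP[e e0 be] := open_nbhs_nbhs (conj oU Uz).
  apply/nbhs_ballP; exists e => // w zw; split; first exact: be.
  rewrite -{1}(subrKC z w); apply: segment_constant => t /andP[t0 t1].
  apply: hF; apply: be; rewrite -ball_normE /= opprD addNKr normrN normrZ.
  rewrite (ger0_norm t0); move: zw; rewrite -ball_normE /= distrC => zw.
  by rewrite (le_lt_trans _ zw)// ler_piMl.
suff : (U `&` [set z | F z = F x]) y by case.
suff -> : U `&` [set z | F z = F x] = U by [].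
apply: cU; first by exists x.
- exists (U `&` [set z | F z = F x]); last by rewrite setIA setIid.
  rewrite openE => z [Uz Fz]; rewrite /interior; move: (near_eq z Uz).
  by apply: filterS => w [Uw Fw]; split => //; rewrite /= Fw.
- exists (~` (U `&` [set z | F z <> F x])).
    apply: open_closedC; rewrite openE => z [Uz Fz].
    rewrite /interior; move: (near_eq z Uz).
    by apply: filterS => w [Uw Fw]; split => //; rewrite /= Fw.
  apply/seteqP; split => z [Uz Fz]; split => //=; first by case.
  by apply: contrapT => h'; apply: Fz.
Qed.

Lemma open_connected_constant m (U : set V) (F : V -> 'rV[R]_m) :
  open U -> connected U ->
  (forall x h, U x -> is_derive x h F 0) ->
  forall x y, U x -> U y -> F y = F x.
Proof.
move=> oU cU hF x y Ux Uy; apply/rowP => i.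
apply: (open_connected_constantR oU cU (F := fun u => F u 0 i)) Ux Uy => z h Uz.
by have := is_derive_coord i (hF _ h Uz); rewrite mxE.
Qed.

End Constant.

Section Lin.
Variables (R : realType) (N m : nat).
Notation V := 'rV[R]_N.

(** A predicate instead of a bundled linear map: derivatives are plain functions of a point and a
    direction, linear only when the point lies in [U]. *)
Definition lin (g : V -> 'rV[R]_m) := forall a u v, g (a *: u + v) = a *: g u + g v.
Variables (g : V -> 'rV[R]_m) (hg : lin g).

Lemma linD u v : g (u + v) = g u + g v.
Proof. by have := hg 1 u v; rewrite !scale1r. Qed.

Lemma lin0 : g 0 = 0.
Proof. by apply: (addrI (g 0)); rewrite -linD !addr0. Qed.

Lemma linZ a u : g (a *: u) = a *: g u.
Proof. by rewrite -[a *: u]addr0 hg lin0 addr0. Qed.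

Lemma linN u : g (- u) = - g u.
Proof. by rewrite -scaleN1r linZ scaleN1r. Qed.

Lemma linB u v : g (u - v) = g u - g v.
Proof. by rewrite linD linN. Qed.

Lemma lin_sum u : g u = \sum_i u 0 i *: g (ev R i).
Proof.
rewrite {1}(sum_ev u) (big_morph g linD lin0).
by apply: eq_bigr => i _; rewrite linZ.
Qed.

Lemma is_derive_lin x h : is_derive x h g (g h).
Proof.
have E : g = \sum_(i < N) (fun y : V => y 0 i *: g (ev R i)).
  by apply/funext => y; rewrite lin_sum fct_sumE.
have H i : is_derive x h (fun y : V => y 0 i *: g (ev R i)) (h 0 i *: g (ev R i)).
  have := is_derive_scale (is_derive_coord i (is_derive_id x h))
    (is_derive_cst (g (ev R i)) x h).
  by rewrite scaler0 addr0.
by rewrite (lin_sum h) [X in is_derive _ _ X _]E; exact: is_derive_sum H.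
Qed.

Lemma lin_mx : exists M : 'M[R]_(N, m), forall u, g u = u *m M.
Proof.
exists (\matrix_i g (ev R i)) => u; rewrite lin_sum mulmx_sum_row.
by apply: eq_bigr => i _; rewrite rowK.
Qed.

End Lin.

Lemma coord_eq (R : realType) (N : nat) (u v : 'rV[R]_N) i : u = v -> u 0 i = v 0 i.
Proof. by move->. Qed.

Section OnOpen.
Variables (R : realType) (V W : normedModType R) (U : set V) (F G : V -> W).

Lemma is_derive_open x v d : open U -> U x -> (forall y, U y -> F y = G y) ->
  is_derive x v F d -> is_derive x v G d.
Proof.
have [->|v0] := eqVneq v 0.
  move=> _ _ _ h; suff -> : d = 0 by exact: is_derive0.
  by case: h => _ <-; exact: derive0.
move=> oU Ux FG; apply: near_eq_is_derive => //.
by apply: filterS (open_nbhs_nbhs (conj oU Ux)) => y /FG ->.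
Qed.

End OnOpen.

(** * Liouville's theorem *)

Section Inversion.
Variables (R : realType) (N : nat).
Implicit Types y h k : 'rV[R]_N.

(** Inversion in the unit sphere centred at [0]. *)
Definition sinv y : 'rV[R]_N := (dot y y)^-1 *: y.

(** The derivative of [sinv] at [y]: [|y|^-2] times the reflection in the hyperplane orthogonal to
    [y]. Hence it is conformal and an involution up to a factor. *)
Definition dsinv y h : 'rV[R]_N :=
  (dot y y)^-1 *: h - (2 * dot y h / dot y y ^+ 2) *: y.

Lemma dsinv_dot y h k : y != 0 ->
  dot (dsinv y h) (dsinv y k) = (dot y y) ^- 2 * dot h k.
Proof.
rewrite -dot_eq0 => y0; rewrite /dsinv !dotE (dotC h y).
by field.
Qed.

Lemma dsinvK y h : y != 0 -> dsinv y (dsinv y h) = (dot y y) ^- 2 *: h.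
Proof.
rewrite -dot_eq0 => y0; rewrite {1}/dsinv /dsinv !dotE.
apply/rowP => j; rewrite !mxE; by field.
Qed.

End Inversion.

(** * The differential equations of a conformal map and their integration *)

Section Liouville.
Variables (R : realType) (N : nat) (hN : (2 < N)%N).
Notation V := 'rV[R]_N.
Variables (U : set V) (f : V -> V) (f1 : V -> V -> V) (f2 : V -> V -> V -> V)
  (f3 : V -> V -> V -> V -> V) (rho : V -> R) (r : V -> V) (r' : V -> V -> V).
Hypotheses (oU : open U) (cU : connected U).
Hypotheses (d0 : forall x h, U x -> is_derive x h f (f1 x h))
  (d1 : forall x h k, U x -> is_derive x k (f1^~ h) (f2 x h k))
  (d2 : forall x h k l, U x -> is_derive x l (fun y => f2 y h k) (f3 x h k l))
  (sym2 : forall x h k, U x -> f2 x h k = f2 x k h)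
  (sym3 : forall x h k l, U x -> f3 x h k l = f3 x h l k)
  (lin1 : forall x, U x -> lin (f1 x))
  (lin2 : forall x h, U x -> lin (f2 x h))
  (rho0 : forall x, U x -> 0 < rho x)
  (drho : forall x l, U x -> is_derive x l rho (dot (r x) l))
  (dr : forall x l, U x -> is_derive x l r (r' x l))
  (conf : forall x h k, U x -> rho x ^+ 2 * dot (f1 x h) (f1 x k) = dot h k).

Lemma conformal_inj x h : U x -> f1 x h = 0 -> h = 0.
Proof.
move=> Ux h0; apply/eqP; rewrite -dot_eq0 -(conf _ _ Ux) h0 dot0l.
by rewrite mulr0.
Qed.

(** In finite dimension the right inverse [rho^2 M^T] of [M] is also a left inverse, so [f1 x] is
    onto. *)
Lemma conformal_orthogonal x w : U x -> (forall l, dot w (f1 x l) = 0) -> w = 0.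
Proof.
move=> Ux hw; have [M ME] := lin_mx (lin1 Ux).
have MM : M *m (rho x ^+ 2 *: M^T) = 1%:M.
  apply/row_matrixP => i; rewrite rowE; apply/rowP => j.
  have -> : (ev R i *m (M *m (rho x ^+ 2 *: M^T))) 0 j
     = rho x ^+ 2 * dot (f1 x (ev R i)) (f1 x (ev R j)).
    rewrite !ME (dotC (ev R i *m M)) dot_mulmx dot_evl.
    by rewrite -!scalemxAr mxE mulmxA.
  by rewrite (conf _ _ Ux) dot_evr rowE mulmx1.
have wM : w *m M^T = 0.
  by apply/rowP => j; rewrite -dot_evr dot_mulmx trmxK -ME hw mxE.
have : w *m ((rho x ^+ 2 *: M^T) *m M) = 0.
  by rewrite -scalemxAl -scalemxAr mulmxA wM mul0mx scaler0.
by rewrite (mulmx1C MM) mulmx1.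
Qed.

(** [conf] is differentiated along [l] and multiplied by [rho x], so that [rho^2 <f1 h, f1 k>] can
    be replaced by [<h, k>]. *)
Lemma conformal_derive x h k l : U x ->
  rho x ^+ 3 * (dot (f2 x h l) (f1 x k) + dot (f1 x h) (f2 x k l))
  + 2 * dot (r x) l * dot h k = 0.
Proof.
move=> Ux.
have D := is_deriveM (is_deriveX 2 (drho l Ux))
   (is_derive_dot (d1 h l Ux) (d1 k l Ux)).
have D0 : is_derive x l (fun=> dot h k) 0 by exact: is_derive_cst.
have := is_derive_unique (is_derive_open oU Ux (fun y => @conf y h k) D) D0.
rewrite !fctE -(conf h k Ux).
rewrite /GRing.scale /= => E.
have -> : rho x ^+ 3 = rho x * rho x ^+ 2 by rewrite exprS.
by rewrite -[RHS](mulr0 (rho x)) -E; ring.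
Qed.

(* Koszul's trick applied to conformal_derive; r is the gradient of rho. *)
Lemma second_derivative x h k : U x ->
  rho x *: f2 x h k =
  dot h k *: f1 x (r x) - dot (r x) k *: f1 x h - dot (r x) h *: f1 x k.
Proof.
move=> Ux; apply/eqP; rewrite -subr_eq0; apply/eqP.
apply: (conformal_orthogonal Ux) => l.
have r0 := rho0 Ux.
apply: (mulfI (lt0r_neq0 (exprn_gt0 2 r0))).
rewrite mulr0.
have C1 := conformal_derive h k l Ux.
have C2 := conformal_derive h l k Ux.
have C3 := conformal_derive k l h Ux.
rewrite !(dotBl, dotZl) !mulrBr.
rewrite (mulrCA _ (dot h k)) (mulrCA _ (dot (r x) k)) (mulrCA _ (dot (r x) h)).
rewrite !conf//.
move: C1 C2 C3; rewrite !(sym2 l)// (sym2 k h)//.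
rewrite !(dotC (f1 x _) (f2 x _ _)) => C1 C2 C3.
rewrite !exprS expr0 mulr1 in C1 C2 C3 *.
lra.
Qed.

Lemma second_derivative_grad x l : U x ->
  f2 x (r x) l = - (dot (r x) (r x) / rho x) *: f1 x l.
Proof.
move=> Ux; have r0 := lt0r_neq0 (rho0 Ux).
have E := second_derivative (r x) l Ux.
apply: (scalerI r0); rewrite E subrr sub0r scalerA.
by rewrite -scaleNr; congr (_ *: _); field.
Qed.

(** Only the maps [f1^~ h] with [h] fixed are known to be differentiable, so [r] is expanded in the
    canonical basis. *)
Lemma is_derive_f1r x l : U x ->
  is_derive x l (fun y => f1 y (r y)) (f1 x (r' x l) + f2 x (r x) l).
Proof.
move=> Ux.
have H i : is_derive x l (fun y => r y 0 i *: f1 y (ev R i))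
   (r' x l 0 i *: f1 x (ev R i) + r x 0 i *: f2 x (ev R i) l).
  by apply: is_derive_scale; [exact: is_derive_coord (dr l Ux)|exact: d1].
have S : \sum_i r x 0 i *: f2 x (ev R i) l = f2 x (r x) l.
  rewrite sym2// (lin_sum (lin2 l Ux)).
  by apply: eq_bigr => i _; rewrite sym2.
have := is_derive_sum H; rewrite big_split /= -(lin_sum (lin1 Ux)) S.
by apply: (is_derive_open oU Ux) => y Uy; rewrite fct_sumE -(lin_sum (lin1 Uy)).
Qed.

Lemma third_derivative x h k l : U x ->
  dot (r x) l *: f2 x h k + rho x *: f3 x h k l =
  dot h k *: (f1 x (r' x l) + f2 x (r x) l)
  - (dot (r' x l) k *: f1 x h + dot (r x) k *: f2 x h l)
  - (dot (r' x l) h *: f1 x k + dot (r x) h *: f2 x k l).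
Proof.
move=> Ux.
have A := is_derive_scale (drho l Ux) (d2 h k l Ux).
have B u v : is_derive x l (fun y => dot (r y) u *: f1 y v)
    (dot (r' x l) u *: f1 x v + dot (r x) u *: f2 x v l).
  apply: is_derive_scale (d1 v l Ux).
  have := is_derive_dot (dr l Ux) (is_derive_cst u x l).
  by rewrite dot0r addr0.
have C := is_deriveB (is_deriveB (is_deriveZ (dot h k) (is_derive_f1r l Ux))
  (B k h)) (B h k).
apply: (is_derive_unique A); apply: (is_derive_open oU Ux _ C) => y Uy.
by rewrite second_derivative.
Qed.

(* third_derivative is antisymmetrised in k and l, where f3 cancels, and f1 x is
   simplified by injectivity. *)
Lemma hessian_identity x h k l (c := dot (r x) (r x) / rho x) : U x ->
  dot h k *: (r' x l - c *: l) - dot h l *: (r' x k - c *: k)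
  - (dot (r' x l) k - dot (r' x k) l) *: h
  - dot (r' x l) h *: k + dot (r' x k) h *: l = 0.
Proof.
move=> Ux; apply: (conformal_inj Ux).
have L1 := lin1 Ux.
rewrite !(linD L1, linN L1, linZ L1).
have E := third_derivative h k l Ux; have F := third_derivative h l k Ux.
rewrite !second_derivative_grad// -/c in E F.
rewrite (sym3 h l k)// (sym2 l k)// in F.
apply/rowP => j.
have := coord_eq j F; have := coord_eq j E.
rewrite !mxE; lra.
Qed.

(* Contraction of hessian_identity over h. *)
Lemma hessian_sym x k l : U x -> dot (r' x l) k = dot (r' x k) l.
Proof.
move=> Ux; apply/eqP; rewrite -subr_eq0; apply/eqP.
set A := _ - _; set c := dot (r x) (r x) / rho x.
have E i : k 0 i * (r' x l 0 i - c * l 0 i) - l 0 i * (r' x k 0 i - c * k 0 i)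
   - A - r' x l 0 i * k 0 i + r' x k 0 i * l 0 i = 0.
  have := coord_eq i (hessian_identity (ev R i) k l Ux).
  rewrite !dot_evl !dot_evr -/A -/c !mxE !eqxx /=; lra.
have {}E (i : 'I_N) : A = 0 by have := E i; lra.
exact: (E (Ordinal (ltn_trans (isT : (0 < 2)%N) hN))).
Qed.

(* Contraction of hessian_identity over h = k; this is where N > 2 is needed. *)
Lemma hessian_scalar x l : U x ->
  r' x l = (dot (r x) (r x) / (2 * rho x)) *: l.
Proof.
move=> Ux; have r0 := lt0r_neq0 (rho0 Ux).
set c := dot (r x) (r x) / rho x.
pose t := \sum_i r' x (ev R i) 0 i.
have N2 : (2 : R) < N%:R by rewrite ltr_nat.
have E j k : N%:R * (r' x k 0 j - c * k 0 j) - (r' x k 0 j - c * k 0 j)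
   - r' x k 0 j + t * k 0 j = 0.
  set A := r' x k 0 j - c * k 0 j.
  have S i : A - k 0 i * (r' x (ev R i) 0 j - c * (ev R i) 0 j)
      - r' x k 0 i * (ev R i) 0 j + r' x (ev R i) 0 i * k 0 j = 0.
    have := coord_eq j (hessian_identity (ev R i) (ev R i) k Ux).
    rewrite (hessian_sym k (ev R i) Ux) subrr scale0r subr0.
    rewrite !dot_evl !dot_evr -/c [RHS]mxE => H; apply: etrans H.
    by rewrite /A !mxE !eqxx /= mul1r.
  have S1 : \sum_i k 0 i * r' x (ev R i) 0 j = r' x k 0 j.
    rewrite -(dot_evr (r' x k)) (hessian_sym _ _ Ux) dotC /dot.
    apply: eq_bigr => i _; congr (_ * _).
    by rewrite -dot_evr (hessian_sym _ _ Ux) dot_evr.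
  have S2 : \sum_i k 0 i * (ev R i) 0 j = k 0 j.
    by rewrite [in RHS](sum_ev k) summxE; apply: eq_bigr => i _; rewrite [RHS]mxE.
  have S3 : \sum_i r' x k 0 i * (ev R i) 0 j = r' x k 0 j.
    by rewrite [in RHS](sum_ev (r' x k)) summxE; apply: eq_bigr => i _; rewrite [RHS]mxE.
  have S12 : \sum_i k 0 i * (r' x (ev R i) 0 j - c * (ev R i) 0 j) = A.
    rewrite /A -[in RHS]S1 -[in RHS]S2 mulr_sumr -sumrB.
    by apply: eq_bigr => i _; ring.
  have : \sum_i (A - k 0 i * (r' x (ev R i) 0 j - c * (ev R i) 0 j)
      - r' x k 0 i * (ev R i) 0 j + r' x (ev R i) 0 i * k 0 j) = 0.
    by apply: big1 => i _; exact: S.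
  rewrite big_split /= sumrB sumrB S12 S3 sumr_const card_ord -mulr_suml -/t.
  by rewrite mulr_natl.
have tE : t = N%:R * (dot (r x) (r x) / (2 * rho x)).
  have S (j : 'I_N) : (N%:R - 2) * r' x (ev R j) 0 j = (N%:R - 1) * c - t.
    by have := E j (ev R j); rewrite mxE !eqxx /=; lra.
  have {S} : (N%:R - 2) * t = N%:R * ((N%:R - 1) * c - t).
    rewrite mulr_sumr (eq_bigr _ (fun j _ => S j)) sumr_const card_ord.
    by rewrite mulr_natl.
  move=> S; have N1 : (N%:R - 1 : R) != 0 by rewrite gt_eqF//; lra.
  apply: (mulfI N1).
  have -> : dot (r x) (r x) / (2 * rho x) = c / 2 by rewrite /c; field.
  lra.
apply/rowP => j; rewrite mxE; have := E j l; rewrite tE.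
have -> : dot (r x) (r x) / (2 * rho x) = c / 2 by rewrite /c; field.
move=> S; have N1 : (N%:R - 2 : R) != 0 by rewrite gt_eqF//; lra.
by apply: (mulfI N1); lra.
Qed.

(** Let [s] be this quotient. As [r' x l = s l], the derivative along [l] is a difference of two
    terms that both equal [s <r, l> / rho]. *)
Lemma curvature_constant x y : U x -> U y ->
  dot (r y) (r y) / (2 * rho y) = dot (r x) (r x) / (2 * rho x).
Proof.
move=> Ux Uy.
apply: (open_connected_constantR oU cU
  (F := fun y => dot (r y) (r y) / (2 * rho y))) Ux Uy => {x y} x l Ux.
have r0 := lt0r_neq0 (rho0 Ux).
have r20 : 2 * rho x != 0 by rewrite mulf_neq0.
have D2 : is_derive x l (fun y => 2 * rho y) (2 * dot (r x) l).
  exact: is_deriveZ (drho l Ux).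
have D := is_deriveM (is_derive_dot (dr l Ux) (dr l Ux))
  (is_derive_invr r20 D2).
apply: is_derive_eq D _; rewrite hessian_scalar// dotZl dotZr (dotC l).
by rewrite /GRing.scale /=; field.
Qed.

(** With [r = 0], the formula for the second derivative makes [f2] vanish. *)
Lemma liouville_affine x0 : U x0 -> (forall x, U x -> r x = 0) ->
  exists (q : V) (M : 'M[R]_N), forall x, U x ->
    f x = q + x *m M /\ forall h, f1 x h = h *m M.
Proof.
move=> Ux0 r0; have [M ME] := lin_mx (lin1 Ux0).
have f1E x h : U x -> f1 x h = h *m M.
  move=> Ux; rewrite -ME; apply: (open_connected_constant oU cU (F := f1^~ h)) Ux0 Ux.
  move=> {}x k Ux; apply: is_derive_eq (d1 h k Ux) _.
  apply: (scalerI (lt0r_neq0 (rho0 Ux))); rewrite second_derivative// r0//.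
  by rewrite !dot0l !scale0r !subr0 scaler0 (lin0 (lin1 Ux)) scaler0.
exists (f x0 - x0 *m M), M => x Ux; split; last by move=> h; exact: f1E.
suff <- : f x - x *m M = f x0 - x0 *m M by rewrite subrK.
apply: (open_connected_constant oU cU (F := fun x => f x - x *m M)) Ux0 Ux.
move=> {}x h Ux.
have L : is_derive x h (fun x : V => x *m M) (h *m M).
  by apply: is_derive_lin => a u v; rewrite mulmxDl -scalemxAl.
apply: is_derive_eq (is_deriveB (d0 h Ux) L) _.
by rewrite f1E// subrr.
Qed.

Lemma liouville_inversive x0 (s := dot (r x0) (r x0) / (2 * rho x0)) :
  U x0 -> s != 0 ->
  exists (q p : V) (M : 'M[R]_N), forall x, U x ->
    [/\ x != p, f x = q + sinv (x - p) *m M &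
        forall h, f1 x h = dsinv (x - p) h *m M].
Proof.
move=> Ux0 s0.
have sE x : U x -> dot (r x) (r x) / (2 * rho x) = s.
  exact: curvature_constant Ux0.
clearbody s.
have r'E x l : U x -> r' x l = s *: l.
  by move=> Ux; rewrite hessian_scalar// sE.
(* r - s x, s f + f1 r and |x - p|^2 (f - q) derived along l are constant. *)
pose p := x0 - s^-1 *: r x0.
have rE x : U x -> r x = s *: (x - p).
  move=> Ux; suff E : r x - s *: x = r x0 - s *: x0.
    apply/rowP => j; have := coord_eq j E.
    by rewrite /p !mxE !mulrBr mulVKf//; lra.
  apply: (open_connected_constant oU cU (F := fun x => r x - s *: x)) Ux0 Ux.
  move=> {}x l Ux.
  apply: is_derive_eq (is_deriveB (dr l Ux) (is_deriveZ s (is_derive_id x l))) _.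
  by rewrite r'E// subrr.
clearbody p.
have rhoE x : U x -> rho x = s * dot (x - p) (x - p) / 2.
  move=> Ux; have r0 := lt0r_neq0 (rho0 Ux).
  have := sE x Ux; rewrite rE// dotZl dotZr => E; apply: (mulfI s0).
  have := congr1 (fun t => t * (2 * rho x)) E.
  by rewrite /= mulfVK ?mulf_neq0//; lra.
(* The value of the Moebius map at infinity. The model is the identity [dsinv y y = - sinv y], which
   reads [f - q = - f1 (x - p)]. *)
pose q := s^-1 *: (s *: f x0 + f1 x0 (r x0)).
have fE x : U x -> f x - q = - f1 x (x - p).
  move=> Ux; suff E : s *: f x + f1 x (r x) = s *: f x0 + f1 x0 (r x0).
    rewrite /q -E rE// (linZ (lin1 Ux)) -scalerDr scalerA mulVf// scale1r.
    by rewrite opprD addNKr.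
  apply: (open_connected_constant oU cU (F := fun x => s *: f x + f1 x (r x))) Ux0 Ux.
  move=> {}x l Ux.
  apply: is_derive_eq (is_deriveD (is_deriveZ s (d0 l Ux)) (is_derive_f1r l Ux)) _.
  have r0 := lt0r_neq0 (rho0 Ux).
  rewrite r'E// (linZ (lin1 Ux)) second_derivative_grad// -!scalerDl.
  suff -> : s + (s + - (dot (r x) (r x) / rho x)) = 0 by rewrite scale0r.
  by rewrite -(sE x Ux); field.
clearbody q.
pose L x l := (2 * dot (x - p) l) *: (f x - q) + dot (x - p) (x - p) *: f1 x l.
have linL : lin (L x0).
  move=> a u v; rewrite /L (lin1 Ux0) !dotE.
  by apply/rowP => j; rewrite !mxE; ring.
have [M ME] := lin_mx linL.
have LE x l : U x -> L x l = l *m M.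
  move=> Ux; rewrite -ME.
  apply: (open_connected_constant oU cU (F := L^~ l)) Ux0 Ux => {}x m Ux.
  have Dy : is_derive x m (fun x => x - p) m.
    apply: is_derive_eq (is_deriveB (is_derive_id x m) (is_derive_cst p x m)) _.
    by rewrite subr0.
  have Df : is_derive x m (fun y => f y - q) (f1 x m).
    apply: is_derive_eq (is_deriveB (d0 m Ux) (is_derive_cst q x m)) _.
    by rewrite subr0.
  have Dd : is_derive x m (fun y => 2 * dot (y - p) l) (2 * dot m l).
    have D := is_derive_dot Dy (is_derive_cst l x m).
    apply: is_derive_eq (is_deriveZ 2 D) _.
    by rewrite dot0r addr0.
  have D1 := is_derive_scale Dd Df.
  have D2 := is_derive_scale (is_derive_dot Dy Dy) (d1 l m Ux).
  apply: is_derive_eq (is_deriveD D1 D2) _.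
  have E := second_derivative l m Ux.
  rewrite rE// rhoE// (linZ (lin1 Ux)) !dotZl in E.
  rewrite fE// (dotC m (x - p)).
  apply: (scalerI s0).
  apply/rowP => j; have := coord_eq j E.
  rewrite !mxE /GRing.scale /= (dotC m l); lra.
exists q, p, M => x Ux.
have yy0 : dot (x - p) (x - p) != 0.
  apply/eqP => y0; have := rho0 Ux.
  by rewrite rhoE// y0 mulr0 mul0r ltxx.
(* [L] at [l = x - p]: because [f1 x (x - p) = q - f x], one of the two copies of [f x - q]
   cancels. *)
have hE : (x - p) *m M = dot (x - p) (x - p) *: (f x - q).
  rewrite -(LE _ _ Ux) /L fE//; apply/rowP => j; rewrite !mxE; ring.
split.
- by apply: contra_neq yy0 => ->; rewrite subrr dot0l.
- by rewrite /sinv -scalemxAl hE scalerA mulVf// scale1r addrC subrK.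
- move=> h; rewrite /dsinv mulmxBl -!scalemxAl hE -(LE _ _ Ux) /L.
  apply/rowP => j; rewrite !mxE; by field.
Qed.

End Liouville.

Definition conformal_mx (R : realType) (N : nat) (M : 'M[R]_N) :=
  exists2 c : R, 0 < c & forall h k : 'rV[R]_N, dot (h *m M) (k *m M) = c * dot h k.

Section Conformal.
Variables (R : realType) (N : nat) (hN : (2 < N)%N).
Notation V := 'rV[R]_N.
Variables (U : set V) (f : V -> V) (f1 : V -> V -> V) (f2 : V -> V -> V -> V)
  (f3 : V -> V -> V -> V -> V).
Hypotheses (oU : open U) (cU : connected U) (U0 : U !=set0).
Hypotheses (d0 : forall x h, U x -> is_derive x h f (f1 x h))
  (d1 : forall x h k, U x -> is_derive x k (f1^~ h) (f2 x h k))
  (d2 : forall x h k l, U x -> is_derive x l (fun y => f2 y h k) (f3 x h k l))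
  (sym2 : forall x h k, U x -> f2 x h k = f2 x k h)
  (sym3 : forall x h k l, U x -> f3 x h k l = f3 x h l k)
  (lin1 : forall x, U x -> lin (f1 x))
  (lin2 : forall x h, U x -> lin (f2 x h))
  (conf : forall x, U x -> exists2 c : R, 0 < c &
     forall h k, dot (f1 x h) (f1 x k) = c * dot h k).

Theorem liouville : exists (q : V) (M : 'M[R]_N),
  conformal_mx M /\
  ((forall x, U x -> f x = q + x *m M /\ forall h, f1 x h = h *m M) \/
   (exists p : V, forall x, U x ->
    [/\ x != p, f x = q + sinv (x - p) *m M &
        forall h, f1 x h = dsinv (x - p) h *m M])).
Proof.
(* rho = 1 / sqrt g, where g is the conformal factor. *)
pose e : V := ev R (Ordinal (ltn_trans (isT : (0 < 2)%N) hN)).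
have ee : dot e e = 1 by rewrite dot_evr mxE !eqxx.
(* [conf] provides the factor only as an existential at each point; its value on a unit vector is an
   expression in [f1], hence differentiable in [x]. *)
pose g x := dot (f1 x e) (f1 x e).
have gE x : U x -> 0 < g x /\ forall h k, dot (f1 x h) (f1 x k) = g x * dot h k.
  by move=> /conf[c c0 cE]; rewrite /g cE ee mulr1; split.
pose rho x := (Num.sqrt (g x))^-1.
have rho0 x : U x -> 0 < rho x.
  by move=> /gE[g0 _]; rewrite invr_gt0 sqrtr_gt0.
have rhoE x : U x -> rho x ^+ 2 * g x = 1.
  move=> /gE[g0 _]; rewrite exprVn sqr_sqrtr ?(ltW g0)// mulVf//.
  by rewrite gt_eqF.
pose r1 x l := - (rho x ^+ 3 * dot (f2 x e l) (f1 x e)).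
have drho1 x l : U x -> is_derive x l rho (r1 x l).
  move=> Ux; have [g0 _] := gE x Ux.
  have s0 : Num.sqrt (g x) != 0 by rewrite gt_eqF// sqrtr_gt0.
  have D := @is_derive_invr R N (Num.sqrt \o g) _ _ _ s0 (is_derive_comp1 (is_derive1_sqrt g0)
    (is_derive_dot (@d1 x e l Ux) (@d1 x e l Ux))).
  apply: is_derive_eq D _.
  rewrite /r1 /rho (dotC (f1 x e)) /GRing.scale /=; by field.
pose r x : V := \row_i r1 x (ev R i).
have drho x l : U x -> is_derive x l rho (dot (r x) l).
  move=> Ux; suff -> : dot (r x) l = r1 x l by exact: drho1.
  rewrite /r1 (lin_sum (lin2 e Ux) l) dot_suml mulr_sumr -sumrN [LHS]/dot.
  by apply: eq_bigr => i _; rewrite mxE dotZl /r1; ring.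
have dr x l : U x -> is_derive x l r ('D_l r x).
  move=> Ux; apply/derivableP; apply/derivable_mxP => i j.
  have D := is_deriveN (is_deriveM (is_deriveX 3 (@drho x l Ux))
    (is_derive_dot (@d2 x e (ev R j) l Ux) (@d1 x e l Ux))).
  rewrite (_ : (fun _ => _) = - ((rho ^+ 3) *
    (fun x => dot (f2 x e (ev R j)) (f1 x e)))); first by case: D.
  by apply/funext => y; rewrite mxE.
have conf' x h k : U x -> rho x ^+ 2 * dot (f1 x h) (f1 x k) = dot h k.
  move=> Ux; have [_ ->] := gE x Ux.
  by rewrite mulrA rhoE// mul1r.
have [x0 Ux0] := U0; have [g0 g0E] := gE x0 Ux0.
have [s0|s0] := eqVneq (dot (r x0) (r x0) / (2 * rho x0)) 0.
  have r0 x : U x -> r x = 0.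
    move=> Ux; apply/eqP; rewrite -dot_eq0.
    have := curvature_constant hN oU cU d1 d2 sym2 sym3 lin1 lin2 rho0 drho dr conf' Ux0 Ux.
    rewrite s0 => /eqP; rewrite mulf_eq0 invr_eq0 mulf_eq0 pnatr_eq0 /=.
    by rewrite (negbTE (lt0r_neq0 (rho0 x Ux))) orbF.
  have [q [M ME]] := liouville_affine oU cU d0 d1 sym2 lin1 rho0 drho conf' Ux0 r0.
  exists q, M; split; last by left.
  exists (g x0) => // h k; have [_ E] := ME x0 Ux0.
  by rewrite -!E g0E.
have [q [p [M ME]]] := liouville_inversive hN oU cU d0 d1 d2 sym2 sym3
  lin1 lin2 rho0 drho dr conf' Ux0 s0.
exists q, M; split; last by right; exists p.
have [y0 _ E] := ME x0 Ux0; rewrite -subr_eq0 in y0; set y := x0 - p in y0 E.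
have yy : 0 < dot y y by rewrite dot_gt0.
exists (g x0 * dot y y ^+ 2) => [|h k]; first by rewrite mulr_gt0// exprn_gt0.
(* [dsinv y] is its own inverse up to the factor [|y|^-4], so [M] is recovered from [f1 x0] and
   inherits its conformality. *)
have F u : u *m M = dot y y ^+ 2 *: f1 x0 (dsinv y u).
  rewrite E dsinvK// -scalemxAl scalerA mulfV ?scale1r//.
  by rewrite expf_neq0// gt_eqF.
rewrite !F dotZl dotZr g0E dsinv_dot//; clearbody y.
have /lt0r_neq0 {}yy := yy; by field.
Qed.

End Conformal.

(** * Cayley-Dickson algebras *)

Section CD.
Variable R : realType.

Lemma cdl_pair n (a b : cd R n) : cdl (cdpair a b) = a.
Proof. exact: row_mxKl. Qed.

Lemma cdr_pair n (a b : cd R n) : cdr (cdpair a b) = b.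
Proof. exact: row_mxKr. Qed.

Lemma cdpairK n (z : cd R n.+1) : cdpair (cdl z) (cdr z) = z.
Proof. exact: hsubmxK. Qed.

Lemma cdlP n a (x y : cd R n.+1) : cdl (a *: x + y) = a *: cdl x + cdl y.
Proof. by apply/rowP => i; rewrite !mxE. Qed.

Lemma cdrP n a (x y : cd R n.+1) : cdr (a *: x + y) = a *: cdr x + cdr y.
Proof. by apply/rowP => i; rewrite !mxE. Qed.

Lemma cdpairP n e (a b c d : cd R n) :
  cdpair (e *: a + c) (e *: b + d) = e *: cdpair a b + cdpair c d.
Proof. by rewrite /cdpair scale_row_mx add_row_mx. Qed.

Lemma dot_pair n (a b c d : cd R n) :
  dot (cdpair a b) (cdpair c d) = dot a c + dot b d.
Proof.
rewrite [LHS]big_split_ord /=; congr (_ + _); apply: eq_bigr => i _.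
  by rewrite /cdpair !row_mxEl.
by rewrite /cdpair !row_mxEr.
Qed.

Lemma cdconjP n a (x y : cd R n) : cdconj (a *: x + y) = a *: cdconj x + cdconj y.
Proof.
elim: n x y => //= n IH x y; rewrite cdlP cdrP IH opprD -scalerN.
exact: cdpairP.
Qed.

Lemma cdconjZ n a (x : cd R n) : cdconj (a *: x) = a *: cdconj x.
Proof.
have h0 : cdconj (0 : cd R n) = 0.
  by have := cdconjP 1 (0 : cd R n) 0; rewrite !scale1r addr0 => /esym/eqP;
     rewrite -subr_eq0 addrK => /eqP.
by rewrite -[a *: x]addr0 cdconjP h0 addr0.
Qed.

Lemma cdconjD n (x y : cd R n) : cdconj (x + y) = cdconj x + cdconj y.
Proof. by have := cdconjP 1 x y; rewrite !scale1r. Qed.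

Lemma cdconjN n (x : cd R n) : cdconj (- x) = - cdconj x.
Proof. by rewrite -scaleN1r cdconjZ scaleN1r. Qed.

Lemma cdmulP n a (x y : cd R n) (z : cd R n) :
  cdmul (a *: x + y) z = a *: cdmul x z + cdmul y z /\
  cdmul z (a *: x + y) = a *: cdmul z x + cdmul z y.
Proof.
elim: n x y z => [|n IH] x y z /=.
  by split; apply/rowP => i; rewrite !mxE; ring.
have Hl x' y' z' := (IH x' y' z').1; have Hr x' y' z' := (IH x' y' z').2.
rewrite !cdlP !cdrP !cdconjP !Hl !Hr -!cdpairP; split; congr cdpair;
 by apply/rowP => i; rewrite !mxE; ring.
Qed.

Lemma cdmulDl n (x y z : cd R n) : cdmul (x + y) z = cdmul x z + cdmul y z.
Proof. by have [+ _] := cdmulP 1 x y z; rewrite !scale1r. Qed.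

Lemma cdmulDr n (x y z : cd R n) : cdmul z (x + y) = cdmul z x + cdmul z y.
Proof. by have [_] := cdmulP 1 x y z; rewrite !scale1r. Qed.

Lemma cdmul0l n (z : cd R n) : cdmul 0 z = 0.
Proof. by apply: (addrI (cdmul 0 z)); rewrite -cdmulDl !addr0. Qed.

Lemma cdmul0r n (z : cd R n) : cdmul z 0 = 0.
Proof. by apply: (addrI (cdmul z 0)); rewrite -cdmulDr !addr0. Qed.

Lemma cdmulZl n a (x z : cd R n) : cdmul (a *: x) z = a *: cdmul x z.
Proof. by have [+ _] := cdmulP a x 0 z; rewrite cdmul0l !addr0. Qed.

Lemma cdmulZr n a (x z : cd R n) : cdmul z (a *: x) = a *: cdmul z x.
Proof. by have [_] := cdmulP a x 0 z; rewrite cdmul0r !addr0. Qed.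

Lemma cdmulNl n (x z : cd R n) : cdmul (- x) z = - cdmul x z.
Proof. by rewrite -scaleN1r cdmulZl scaleN1r. Qed.

Lemma cdmulNr n (x z : cd R n) : cdmul z (- x) = - cdmul z x.
Proof. by rewrite -scaleN1r cdmulZr scaleN1r. Qed.

Lemma cdconjK n (x : cd R n) : cdconj (cdconj x) = x.
Proof. by elim: n x => //= n IH x; rewrite cdl_pair cdr_pair IH opprK cdpairK. Qed.

Lemma cdconjM n (x y : cd R n) :
  cdconj (cdmul x y) = cdmul (cdconj y) (cdconj x).
Proof.
elim: n x y => [|n IH] x y /=; first by apply/rowP => i; rewrite !mxE mulrC.
rewrite !cdl_pair !cdr_pair; congr cdpair.
  by rewrite cdconjD cdconjN !IH !cdconjN cdmulNl cdmulNr opprK cdconjK.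
by rewrite cdconjK !cdmulNl opprD addrC.
Qed.

Lemma cdl0 n : cdl (0 : cd R n.+1) = 0.
Proof. by apply/rowP => i; rewrite !mxE. Qed.
Lemma cdconj1 n : cdconj (cdone R n) = cdone R n.
Proof. by elim: n => //= n IH; rewrite cdl_pair cdr_pair IH oppr0. Qed.

Lemma cdmul1l n (x : cd R n) : cdmul (cdone R n) x = x.
Proof.
elim: n x => [|n IH] x /=; first by apply/rowP => i; rewrite !mxE mul1r.
rewrite cdl_pair cdr_pair IH cdmul0r cdmul0l.
have -> : cdmul (cdr x) (cdone R n) = cdr x.
  by rewrite -[LHS]cdconjK cdconjM cdconj1 IH cdconjK.
by rewrite subr0 addr0 cdpairK.
Qed.

Lemma cdmul1r n (x : cd R n) : cdmul x (cdone R n) = x.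
Proof. by rewrite -[LHS]cdconjK cdconjM cdconj1 cdmul1l cdconjK. Qed.

Lemma cdreP n a (x y : cd R n) : cdre (a *: x + y) = a * cdre x + cdre y.
Proof. by elim: n x y => [|n IH] x y /=; rewrite ?mxE ?cdlP ?IH// !mxE. Qed.

Lemma cdre0 n : cdre (0 : cd R n) = 0.
Proof. by elim: n => [|n IH] /=; rewrite ?mxE ?cdl0. Qed.

Lemma cdreZ n a (x : cd R n) : cdre (a *: x) = a * cdre x.
Proof. by rewrite -[a *: x]addr0 cdreP cdre0 addr0. Qed.

Lemma cdreD n (x y : cd R n) : cdre (x + y) = cdre x + cdre y.
Proof. by rewrite -[x]scale1r cdreP scale1r mul1r. Qed.

Lemma cdreN n (x : cd R n) : cdre (- x) = - cdre x.
Proof. by rewrite -scaleN1r cdreZ mulN1r. Qed.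

Lemma cdre_conj n (x : cd R n) : cdre (cdconj x) = cdre x.
Proof. by elim: n x => //= n IH x; rewrite cdl_pair IH. Qed.

Lemma cdre_mulC n (x y : cd R n) : cdre (cdmul x y) = cdre (cdmul y x).
Proof.
elim: n x y => [|n IH] x y /=; first by rewrite !mxE mulrC.
rewrite !cdl_pair !cdreD !cdreN IH; congr (_ - _).
by rewrite -cdre_conj cdconjM cdconjK.
Qed.

Lemma cdre_dot n (x y : cd R n) : cdre (cdmul x (cdconj y)) = dot x y.
Proof.
elim: n x y => [|n IH] x y /=; first by rewrite mxE /dot big_ord1.
rewrite !cdl_pair !cdr_pair cdreD cdreN IH cdconjN cdmulNl cdreN opprK.
by rewrite cdre_mulC IH -[in RHS](cdpairK x) -[in RHS](cdpairK y) dot_pair.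
Qed.

Lemma cdre_dot1 n (x : cd R n) : cdre x = dot x (cdone R n).
Proof. by rewrite -cdre_dot cdconj1 cdmul1r. Qed.

Lemma dot11 n : dot (cdone R n) (cdone R n) = 1.
Proof.
elim: n => [|n IH] /=; first by rewrite /dot big_ord1 !mxE mulr1.
by rewrite dot_pair IH dot0l addr0.
Qed.

Lemma cdconjE n (x : cd R n) : cdconj x = (2 * cdre x) *: cdone R n - x.
Proof.
elim: n x => [|n IH] x /=.
  by apply/rowP => i; rewrite !mxE (ord1 i); ring.
rewrite IH; set c := 2 * _.
have -> : c *: cdpair (cdone R n) 0 - x =
    cdpair (c *: cdone R n - cdl x) (c *: 0 - cdr x).
  by rewrite -{1}[x]cdpairK /cdpair scale_row_mx opp_row_mx add_row_mx.
by rewrite scaler0 sub0r.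
Qed.

Lemma dot_conj n (x y : cd R n) : dot (cdconj x) (cdconj y) = dot x y.
Proof.
elim: n x y => //= n IH x y.
by rewrite dot_pair IH dotNl dotNr opprK -dot_pair !cdpairK.
Qed.

Lemma cdabsE n (x : cd R n) : cdabs x = Num.sqrt (dot x x).
Proof. by rewrite /cdabs cdre_dot. Qed.

Definition cd_assoc n := forall x y z : cd R n,
  cdmul x (cdmul y z) = cdmul (cdmul x y) z.
Definition cd_comm n := forall x y : cd R n, cdmul x y = cdmul y x.
Definition composition n := forall x y : cd R n,
  dot (cdmul x y) (cdmul x y) = dot x x * dot y y.

Lemma cd_comm_double n : (forall x : cd R n, cdconj x = x) -> cd_comm n -> cd_comm n.+1.
Proof.
move=> hx hc x y /=; rewrite !hx; congr cdpair.
  by rewrite (hc (cdl x)) (hc (cdr x)).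
by rewrite addrC (hc (cdr x)) (hc (cdr y)) (hc (cdl y)) (hc (cdl x)).
Qed.

Lemma cd_assoc_double n : cd_assoc n -> cd_comm n -> cd_assoc n.+1.
Proof.
move=> ha hc x y z /=; rewrite !cdl_pair !cdr_pair.
move: (cdl x) (cdr x) (cdl y) (cdr y) (cdl z) (cdr z) => a b c d e f.
rewrite !(cdconjD, cdconjN, cdconjM, cdconjK, cdmulDl, cdmulDr, cdmulNl, cdmulNr).
have hCA (p q s : cd R n) : cdmul p (cdmul q s) = cdmul q (cdmul p s).
  by rewrite !ha (hc p).
rewrite -!ha (hCA a (cdconj f) d) (hc a d) (hCA (cdconj c) (cdconj f) b).
rewrite (hc (cdconj c) b) (hCA e (cdconj d) b) (hc e b) (hc c a).
rewrite (hc (cdconj e) a) (hc (cdconj e) (cdconj c)) (hCA b (cdconj d) f).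
rewrite (hc b f) (hCA (cdconj d) f b).
by congr cdpair; apply/rowP => i; rewrite !mxE; ring.
Qed.

Lemma dot_mull n : cd_assoc n ->
  forall x y z : cd R n, dot (cdmul x y) z = dot y (cdmul (cdconj x) z).
Proof.
move=> ha x y z; rewrite -[LHS]cdre_dot -[RHS]cdre_dot cdconjM cdconjK.
by rewrite -ha cdre_mulC ha.
Qed.

Lemma dot_mulr n : cd_assoc n ->
  forall x y z : cd R n, dot (cdmul x y) z = dot x (cdmul z (cdconj y)).
Proof.
move=> ha x y z; rewrite -[LHS]cdre_dot -[RHS]cdre_dot cdconjM cdconjK.
by rewrite -ha.
Qed.

(** The squares add up to the right-hand side. The cross terms [<ac, d~ b>] and [<da, b c~>] come
    with opposite signs and agree by adjunction and associativity. *)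
Lemma composition_double n : cd_assoc n -> composition n -> composition n.+1.
Proof.
move=> ha hn x y /=.
rewrite -[in RHS](cdpairK x) -[in RHS](cdpairK y) !dot_pair.
move: (cdl x) (cdr x) (cdl y) (cdr y) => a b c d.
rewrite !dotE !hn !dot_conj.
have E : dot (cdmul a c) (cdmul (cdconj d) b) = dot (cdmul d a) (cdmul b (cdconj c)).
  by rewrite -dot_mulr// -ha [RHS]dot_mull.
rewrite (dotC (cdmul (cdconj d) b)) (dotC (cdmul b (cdconj c))) E.
ring.
Qed.

(** Each doubling loses one property: the complex numbers are still commutative, the quaternions
    still associative, and the octonions keep only the composition law, which rests on
    [cd_assoc 2]. *)
Lemma composition_le3 n : (n <= 3)%N -> composition n.
Proof.
have c0 : cd_comm 0 by move=> x y; apply/rowP => i; rewrite !mxE mulrC.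
have a0 : cd_assoc 0 by move=> x y z; apply/rowP => i; rewrite !mxE mulrA.
have c1 : cd_comm 1 by exact: cd_comm_double.
have a1 := cd_assoc_double a0 c0; have a2 := cd_assoc_double a1 c1.
have n0 : composition 0.
  by move=> x y; rewrite /dot !big_ord1 /= !mxE; ring.
have n1 := composition_double a0 n0; have n2 := composition_double a1 n1.
by case: n => [|[|[|[|]]]]// _; exact: composition_double.
Qed.

End CD.

(** * Consequences of the multiplicative norm *)

Section Composition.
Variables (R : realType) (n : nat) (hn : composition R n).
Notation K := (cd R n).
Implicit Types (x y z : K).

Lemma cdabsM x y : cdabs (cdmul x y) = cdabs x * cdabs y.
Proof. by rewrite !cdabsE hn sqrtrM// dot_ge0. Qed.

Lemma dot_mul_l x y z : dot (cdmul x y) (cdmul x z) = dot x x * dot y z.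
Proof.
have := hn x (y + z); rewrite cdmulDr !dotE !hn (dotC z y).
rewrite (dotC (cdmul x z)); lra.
Qed.

Lemma dot_mul_r x y z : dot (cdmul y x) (cdmul z x) = dot x x * dot y z.
Proof.
have := hn (y + z) x; rewrite cdmulDl !dotE !hn (dotC z y).
rewrite (dotC (cdmul z x)); lra.
Qed.

Lemma dot_mul_polar x w y z :
  dot (cdmul x y) (cdmul w z) + dot (cdmul x z) (cdmul w y) = 2 * dot x w * dot y z.
Proof.
have := dot_mul_l (x + w) y z; rewrite !cdmulDl !dotE !dot_mul_l.
rewrite (dotC (cdmul w y)) (dotC w x); lra.
Qed.

(** [dot_mull] rests on associativity, which fails for octonions. Here the polar identity with
    [w = 1] and [x~ = 2 Re x - x] give the same conclusion from the norm alone. *)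
Lemma dot_adjl x y z : dot (cdmul x y) z = dot y (cdmul (cdconj x) z).
Proof.
have := dot_mul_polar x (cdone R n) y z; rewrite !cdmul1l -cdre_dot1.
rewrite cdconjE cdmulDl cdmulNl cdmulZl cdmul1l !dotE.
rewrite (dotC (cdmul x z)); lra.
Qed.

Lemma dot_adjr x y z : dot (cdmul x y) z = dot x (cdmul z (cdconj y)).
Proof.
by rewrite -dot_conj cdconjM dot_adjl cdconjK -dot_conj cdconjK cdconjM cdconjK.
Qed.

Lemma cdmul_conjK x y : cdmul (cdconj x) (cdmul x y) = dot x x *: y.
Proof. by apply: dotP => z; rewrite dot_adjl cdconjK dot_mul_l dotZl. Qed.

Lemma cdmulK_conj x y : cdmul (cdmul y x) (cdconj x) = dot x x *: y.
Proof. by apply: dotP => z; rewrite dot_adjr cdconjK dot_mul_r dotZl. Qed.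

Lemma cdmul_conj_polar x y :
  cdmul x (cdconj y) + cdmul y (cdconj x) = (2 * dot x y) *: cdone R n.
Proof.
have h z : cdmul z (cdconj z) = dot z z *: cdone R n.
  by rewrite -{1}[z]cdmul1l cdmulK_conj.
have := h (x + y); rewrite cdconjD !cdmulDl !cdmulDr !h !dotE (dotC y x) => E.
apply/rowP => j; have : forall u v : K, u = v -> u 0 j = v 0 j by move=> u v ->.
by move=> /(_ _ _ E); rewrite !mxE; lra.
Qed.

(** From [x z + z~ x~ = 2 <x, z~>], multiplied by [x] on the right. Summed over a basis it expresses
    conjugation; with [z = h~] it is the derivative of the inversion up to a factor. *)
Lemma mul_mul_self x z :
  cdmul (cdmul x z) x = (2 * dot x (cdconj z)) *: x - dot x x *: cdconj z.
Proof.
have := cdmul_conj_polar x (cdconj z); rewrite cdconjK => /(canRL (addrK _)) ->.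
rewrite cdmulDl cdmulNl cdmulZl cdmul1l; congr (_ - _).
by rewrite -{2}[x]cdconjK cdmulK_conj dot_conj.
Qed.

(** [mul_mul_self] over an orthonormal basis: the first terms reassemble [2 z~], the others
    contribute [N z~]. *)
Lemma sum_mul_ev z : \sum_i cdmul (cdmul (ev R i) z) (ev R i)
  = (2 - (cdim n)%:R) *: cdconj z.
Proof.
rewrite (eq_bigr _ (fun i _ => mul_mul_self (ev R i) z)) sumrB.
under eq_bigr do rewrite -scalerA dot_evl.
rewrite -scaler_sumr -sum_ev scalerBl; congr (_ - _).
under eq_bigr do rewrite dot_evr mxE !eqxx scale1r.
by rewrite sumr_const card_ord scaler_nat.
Qed.

End Composition.

(** * Regularity of phrases *)

Section NonnegPoly.
Variable R : realType.
Implicit Types (p q : {poly R}) (a b c s : R).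

Definition nnegp p := forall i, 0 <= p`_i.

Lemma nnegpC c : 0 <= c -> nnegp c%:P.
Proof. by move=> c0 i; rewrite coefC; case: eqP. Qed.

Lemma nnegpX : nnegp 'X.
Proof. by move=> i; rewrite coefX; case: eqP. Qed.

Lemma nnegpD p q : nnegp p -> nnegp q -> nnegp (p + q).
Proof. by move=> hp hq i; rewrite coefD addr_ge0. Qed.

Lemma nnegpM p q : nnegp p -> nnegp q -> nnegp (p * q).
Proof.
by move=> hp hq i; rewrite coefM sumr_ge0// => j _; rewrite mulr_ge0.
Qed.

Lemma nnegp_deriv p : nnegp p -> nnegp p^`().
Proof. by move=> hp i; rewrite coef_deriv mulrn_wge0. Qed.

Lemma nnegp_shift p a : 0 <= a -> nnegp p -> nnegp (p \Po ('X + a%:P)).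
Proof.
move=> a0; elim/poly_ind: p => [|p c IH] hp; first by rewrite comp_poly0.
rewrite comp_polyD comp_polyM comp_polyX comp_polyC; apply: nnegpD.
  apply: nnegpM; last by apply: nnegpD; [exact: nnegpX|exact: nnegpC].
  by apply: IH => i; have := hp i.+1; rewrite coefD coefMX coefC addr0.
by apply: nnegpC; have := hp 0; rewrite coefD coefMX coefC add0r.
Qed.

Lemma nnegp_le p s t : nnegp p -> 0 <= s -> s <= t -> p.[s] <= p.[t].
Proof.
move=> hp s0 st; rewrite !horner_coef; apply: ler_sum => i _.
by rewrite ler_wpM2l// lerXn2r// nnegrE// (le_trans s0).
Qed.

Lemma nnegp_ge0 p s : nnegp p -> 0 <= s -> 0 <= p.[s].
Proof.
by move=> hp s0; rewrite horner_coef sumr_ge0// => i _; rewrite mulr_ge0// exprn_ge0.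
Qed.

Definition taylor_rem p a b := p.[a + b] - p.[a] - b * p^`().[a].

(** [q] consists of the coefficients from degree 2 on of [p] recentred at [a]; recentring at a
    nonnegative point keeps coefficients nonnegative. *)
Lemma taylor_remE p a b : nnegp p -> 0 <= a -> exists2 q, nnegp q &
  forall b, taylor_rem p a b = b ^+ 2 * q.[b].
Proof.
move=> hp a0; pose s := p \Po ('X + a%:P); exists (drop_poly 2 s).
  by move=> i; rewrite coef_drop_poly; exact: nnegp_shift.
move=> {}b; rewrite /taylor_rem.
have sE x : s.[x] = p.[a + x] by rewrite horner_comp !hornerE addrC.
have s0 : s`_0 = p.[a] by rewrite -horner_coef0 sE addr0.
have s1 : s`_1 = p^`().[a].
  have : s^`().[0] = s`_1 by rewrite horner_coef0 coef_deriv.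
  move=> <-; rewrite deriv_comp derivD derivX derivC addr0 mulr1 horner_comp.
  by rewrite !hornerE.
rewrite -sE -(poly_take_drop 2 s) hornerD hornerM hornerXn.
have -> : (take_poly 2 s).[b] = s`_0 + s`_1 * b.
  rewrite (horner_coef_wide _ (size_take_poly _ _)) !big_ord_recl big_ord0.
  by rewrite !coef_take_poly /= expr0 expr1 mulr1 addr0.
rewrite s0 s1 poly_take_drop; ring.
Qed.

Lemma taylor_rem_ge0 p a b : nnegp p -> 0 <= a -> 0 <= b -> 0 <= taylor_rem p a b.
Proof.
move=> hp a0 b0; have [q hq ->] := taylor_remE b hp a0.
by rewrite mulr_ge0 ?sqr_ge0// nnegp_ge0.
Qed.

(** The graph lies above its tangent at [s]. This plays the part of Cauchy's estimate: a derivative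
    is controlled by a value at a larger radius. *)
Lemma nnegp_deriv_le p s t : nnegp p -> 0 <= s -> s < t ->
  p^`().[s] <= (t - s)^-1 * p.[t].
Proof.
move=> hp s0 st; have := @taylor_rem_ge0 p s (t - s) hp s0.
rewrite /taylor_rem subrKC subr_ge0 (ltW st) => /(_ isT).
have := nnegp_ge0 hp s0; rewrite ler_pdivlMl ?subr_gt0//; lra.
Qed.

(** [taylor_rem p a b / b^2] increases with [b], so it is estimated at [c]. The bound is linear in
    the value [p.[a + c]] and can therefore be summed over a series of majorants. *)
Lemma taylor_rem_le p a b c : nnegp p -> 0 <= a -> 0 <= b -> b <= c -> 0 < c ->
  taylor_rem p a b <= b ^+ 2 * (c ^- 2 * p.[a + c]).
Proof.
move=> hp a0 b0 bc c0; have [q hq qE] := taylor_remE b hp a0.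
rewrite qE ler_wpM2l ?sqr_ge0// (le_trans (nnegp_le hq b0 bc))//.
rewrite ler_pdivlMl ?exprn_gt0// -qE /taylor_rem.
have := nnegp_ge0 hp a0; have := nnegp_ge0 (nnegp_deriv hp) a0.
move=> d0 p0; have := mulr_ge0 (ltW c0) d0; lra.
Qed.

End NonnegPoly.

Section Abs.
Variables (R : realType) (n : nat).
Notation K := (cd R n).
Implicit Types x y : K.

Lemma cdabs_ge0 x : 0 <= cdabs x.
Proof. by rewrite cdabsE sqrtr_ge0. Qed.

Lemma cdabs_sqr x : cdabs x ^+ 2 = dot x x.
Proof. by rewrite cdabsE sqr_sqrtr// dot_ge0. Qed.

Lemma cdabs0 : cdabs (0 : K) = 0.
Proof. by rewrite cdabsE dot0l sqrtr0. Qed.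

Lemma cdabsZ a x : cdabs (a *: x) = `|a| * cdabs x.
Proof.
by rewrite !cdabsE dotZl dotZr mulrA -expr2 sqrtrM ?sqr_ge0// sqrtr_sqr.
Qed.

Lemma cdabs_eq0 x : (cdabs x == 0) = (x == 0).
Proof. by rewrite -(sqrf_eq0 (cdabs x)) cdabs_sqr dot_eq0. Qed.

Lemma cdabs_gt0 x : (0 < cdabs x) = (x != 0).
Proof. by rewrite lt0r cdabs_ge0 andbT cdabs_eq0. Qed.

Lemma cdabs_conj x : cdabs (cdconj x) = cdabs x.
Proof. by rewrite !cdabsE dot_conj. Qed.

Lemma dot_le_cdabs x y : dot x y <= cdabs x * cdabs y.
Proof.
rewrite (le_trans (ler_norm _))// -(ler_sqr (x := `|_|)) ?nnegrE ?mulr_ge0 ?cdabs_ge0//.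
by rewrite real_normK ?num_real// exprMn !cdabs_sqr cauchy_dot.
Qed.

Lemma cdabsD x y : cdabs (x + y) <= cdabs x + cdabs y.
Proof.
rewrite -ler_sqr ?nnegrE ?addr_ge0 ?cdabs_ge0// sqrrD !cdabs_sqr !dotE (dotC y x).
by have := dot_le_cdabs x y; lra.
Qed.

Lemma cdabs_coord x i : `|x 0 i| <= cdabs x.
Proof.
rewrite -ler_sqr ?nnegrE ?cdabs_ge0// real_normK ?num_real// cdabs_sqr /dot.
by rewrite (bigD1 i)//= -expr2 lerDl sumr_ge0// => j _; rewrite -expr2 sqr_ge0.
Qed.

Lemma cdabs_le_norm x : cdabs x <= Num.sqrt (cdim n)%:R * `|x|.
Proof.
rewrite -ler_sqr ?nnegrE ?mulr_ge0 ?cdabs_ge0 ?sqrtr_ge0// cdabs_sqr exprMn.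
rewrite sqr_sqrtr ?ler0n// /dot mulr_natl -[X in _ *+ X]card_ord -sumr_const.
apply: ler_sum => i _; rewrite -expr2 -real_normK ?num_real//.
rewrite lerXn2r ?nnegrE// [leRHS]/Num.Def.normr /= mx_normrE.
by apply/bigmax_geP; right; exists (0, i).
Qed.

Lemma cdabs_near (a : K) (x : K) e : cdabs (x - a) < e ->
  \forall y \near x, cdabs (y - a) < e.
Proof.
move=> xe; set d := e - cdabs (x - a); have d0 : 0 < d by rewrite subr_gt0.
pose c := Num.sqrt (cdim n)%:R + 1 : R.
have c0 : 0 < c by rewrite ltr_wpDl ?sqrtr_ge0.
apply/nbhs_ballP; exists (d / c); first by rewrite /= divr_gt0.
move=> y; rewrite -ball_normE /= distrC ltr_pdivlMr// => yd.
have -> : y - a = (y - x) + (x - a) by rewrite subrKA.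
rewrite (le_lt_trans (cdabsD _ _))//.
have : cdabs (y - x) < d.
  rewrite (le_lt_trans (cdabs_le_norm _))// (le_lt_trans _ yd)//.
  by rewrite mulrC ler_wpM2l// lerDl.
rewrite /d; lra.
Qed.

End Abs.

(** * Terms, their derivatives and their majorants *)

Section Terms.
Variables (R : realType) (n : nat) (hn : composition R n).
Notation K := (cd R n).

(** Words enriched with sums, which makes the class closed under [pder]; derivatives of all orders
    are then covered by one estimate. *)
Inductive pterm : Type :=
| PConst of K
| PVar
| PBar
| PMul of pterm & pterm
| PAdd of pterm & pterm.

Fixpoint peval (t : pterm) (z : K) : K :=
  match t with
  | PConst c => c
  | PVar => z
  | PBar => cdconj z
  | PMul u v => cdmul (peval u z) (peval v z)
  | PAdd u v => peval u z + peval v z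
  end.

Fixpoint pder (h : K) (t : pterm) : pterm :=
  match t with
  | PConst _ => PConst 0
  | PVar => PConst h
  | PBar => PConst (cdconj h)
  | PMul u v => PAdd (PMul (pder h u) v) (PMul u (pder h v))
  | PAdd u v => PAdd (pder h u) (pder h v)
  end.

Fixpoint majorant (t : pterm) : {poly R} :=
  match t with
  | PConst c => (cdabs c)%:P
  | PVar | PBar => 'X
  | PMul u v => majorant u * majorant v
  | PAdd u v => majorant u + majorant v
  end.

Lemma nnegp_majorant t : nnegp (majorant t).
Proof.
elim: t => [c| | |u hu v hv|u hu v hv] /=.
- exact/nnegpC/cdabs_ge0.
- exact: nnegpX.
- exact: nnegpX.
- exact: nnegpM.
- exact: nnegpD.
Qed.

Lemma majorant_pder h t : majorant (pder h t) = cdabs h *: (majorant t)^`().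
Proof.
elim: t => [c| | |u hu v hv|u hu v hv] /=.
- by rewrite cdabs0 derivC scaler0.
- by rewrite derivX alg_polyC.
- by rewrite derivX cdabs_conj alg_polyC.
- by rewrite hu hv derivM scalerDr -scalerAl -scalerAr.
- by rewrite hu hv derivD scalerDr.
Qed.

Lemma peval_bound t x s : cdabs x <= s -> cdabs (peval t x) <= (majorant t).[s].
Proof.
move=> xs; elim: t => [c| | |u hu v hv|u hu v hv] /=; rewrite ?hornerE //.
- by rewrite cdabs_conj.
- by rewrite cdabsM// ler_pM ?cdabs_ge0.
- by rewrite (le_trans (cdabsD _ _))// lerD.
Qed.

Lemma peval_diff t x h a b : cdabs x <= a -> cdabs h <= b ->
  cdabs (peval t (x + h) - peval t x) <= (majorant t).[a + b] - (majorant t).[a].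
Proof.
move=> xa hb; have xhab : cdabs (x + h) <= a + b.
  by rewrite (le_trans (cdabsD _ _))// lerD.
elim: t => [c| | |u hu v hv|u hu v hv] /=; rewrite ?hornerE.
- by rewrite subrr cdabs0 subrr.
- by rewrite addrC addKr addrC addKr.
- by rewrite cdconjD addrC addKr cdabs_conj addrC addKr.
- have -> : cdmul (peval u (x + h)) (peval v (x + h)) - cdmul (peval u x) (peval v x)
    = cdmul (peval u (x + h) - peval u x) (peval v (x + h))
      + cdmul (peval u x) (peval v (x + h) - peval v x).
    by rewrite cdmulDl cdmulDr cdmulNl cdmulNr addrA subrK.
  rewrite (le_trans (cdabsD _ _))// !cdabsM//.
  have := ler_pM (cdabs_ge0 _) (cdabs_ge0 _) hu (peval_bound v xhab).
  have := ler_pM (cdabs_ge0 _) (cdabs_ge0 _) (peval_bound u xa) hv.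
  lra.
- have -> : peval u (x + h) + peval v (x + h) - (peval u x + peval v x)
    = (peval u (x + h) - peval u x) + (peval v (x + h) - peval v x).
    by rewrite opprD addrACA.
  by rewrite (le_trans (cdabsD _ _))//; lra.
Qed.

(** The remainder of a product is [Du Dv + rem_u v + u rem_v], with [D] the increment. The same
    identity holds for the majorants, where every factor is nonnegative, so the bounds multiply. *)
Lemma peval_rem t x h a b : cdabs x <= a -> cdabs h <= b ->
  cdabs (peval t (x + h) - peval t x - peval (pder h t) x)
  <= taylor_rem (majorant t) a b.
Proof.
move=> xa hb; have xhab : cdabs (x + h) <= a + b.
  by rewrite (le_trans (cdabsD _ _))// lerD.
rewrite /taylor_rem.
elim: t => [c| | |u hu v hv|u hu v hv] /=; rewrite ?(derivC, derivX, derivM, derivD) ?hornerE.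
- by rewrite subrr subr0 cdabs0; lra.
- by rewrite addrAC addrK subrr cdabs0; lra.
- by rewrite cdconjD addrAC addrK subrr cdabs0; lra.
- have -> : cdmul (peval u (x + h)) (peval v (x + h)) - cdmul (peval u x) (peval v x)
     - (cdmul (peval (pder h u) x) (peval v x) + cdmul (peval u x) (peval (pder h v) x))
    = cdmul (peval u (x + h) - peval u x) (peval v (x + h) - peval v x)
      + cdmul (peval u (x + h) - peval u x - peval (pder h u) x) (peval v x)
      + cdmul (peval u x) (peval v (x + h) - peval v x - peval (pder h v) x).
    rewrite !(cdmulDl, cdmulDr, cdmulNl, cdmulNr).
    by apply/rowP => i; rewrite !mxE; ring.
  rewrite (le_trans (cdabsD _ _))// (le_trans (lerD (cdabsD _ _) (lexx _)))// !cdabsM//.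
  have := ler_pM (cdabs_ge0 _) (cdabs_ge0 _) (peval_diff u xa hb) (peval_diff v xa hb).
  have := ler_pM (cdabs_ge0 _) (cdabs_ge0 _) hu (peval_bound v xa).
  have := ler_pM (cdabs_ge0 _) (cdabs_ge0 _) (peval_bound u xa) hv.
  lra.
- have -> : peval u (x + h) + peval v (x + h) - (peval u x + peval v x)
       - (peval (pder h u) x + peval (pder h v) x)
    = (peval u (x + h) - peval u x - peval (pder h u) x)
      + (peval v (x + h) - peval v x - peval (pder h v) x).
    by apply/rowP => i; rewrite !mxE; ring.
  by rewrite (le_trans (cdabsD _ _))//; lra.
Qed.

Lemma peval_pder_lin t x : lin (fun h => peval (pder h t) x).
Proof.
move=> a h k; elim: t => [c| | |u hu v hv|u hu v hv] /=.
- by rewrite scaler0 addr0.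
- by [].
- exact: cdconjP.
- rewrite hu hv !(cdmulDl, cdmulDr, cdmulZl, cdmulZr).
  by apply/rowP => i; rewrite !mxE; ring.
- by rewrite hu hv scalerDr addrACA.
Qed.

Lemma peval_pder_sym t x h k :
  peval (pder h (pder k t)) x = peval (pder k (pder h t)) x.
Proof.
elim: t => [c| | |u hu v hv|u hu v hv] //=.
  rewrite hu hv; apply/rowP => i; rewrite !mxE; ring.
by rewrite hu hv.
Qed.

Fixpoint pterm_of_word (w : word R n) : pterm :=
  match w with
  | WConst c => PConst c
  | WVar => PVar
  | WBar => PBar
  | WMul u v => PMul (pterm_of_word u) (pterm_of_word v)
  end.

Lemma peval_word w z : peval (pterm_of_word w) z = weval w z.
Proof. by elim: w => //= u -> v ->. Qed.

Lemma peval_pder_word w z h :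
  peval (pder h (pterm_of_word w)) z = wdz w z h + wdzbar w z h.
Proof.
elim: w => [c| | |u hu v hv] /=; rewrite ?addr0 ?add0r//.
rewrite hu hv !peval_word !cdmulDl !cdmulDr.
by rewrite addrACA.
Qed.

(* Words have no sums and the norm is multiplicative: the absolute convergence
   of a phrase at one point gives a radius of convergence. *)
Lemma majorant_word w z : (majorant (pterm_of_word w)).[cdabs z] = cdabs (weval w z).
Proof.
elim: w => [c| | |u hu v hv] /=; rewrite ?hornerE ?cdabs_conj//.
by rewrite hu hv cdabsM.
Qed.

End Terms.

Section QuadraticRemainder.
Variables (R : realType) (V : normedModType R).

Lemma quadratic_is_derive (F : V -> R) x v d (C e : R) : 0 < e ->
  (forall s, `|s| < e -> `|F (x + s *: v) - F x - s * d| <= s ^+ 2 * C) ->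
  is_derive x v F d.
Proof.
move=> e0 H.
have C0 : 0 <= C.
  have /H : `|e / 2| < e by rewrite gtr0_norm ?divr_gt0//; lra.
  move/(le_trans (normr_ge0 _)); rewrite pmulr_rge0// exprn_gt0//; lra.
suff L : (fun s : R => s^-1 *: ((F \o shift x) (s *: v) - F x)) @ 0^' --> d.
  by split; [apply/cvg_ex; exists d|apply: cvg_lim L].
apply/cvgrPdist_lt => eps eps0; near=> s.
have s0 : s != 0 by near: s; exact: nbhs_dnbhs_neq.
have -> : d - s^-1 *: ((F \o shift x) (s *: v) - F x)
    = - (s^-1 * (F (x + s *: v) - F x - s * d)).
  rewrite /= (addrC (s *: v)) [in RHS]mulrBr mulKf//.
  by rewrite opprB.
rewrite normrN normrM normfV mulrC ltr_pdivrMr ?normr_gt0//.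
have se : `|s| < e by near: s; exact: dnbhs0_lt.
rewrite (le_lt_trans (H s se))// -real_normK ?num_real// expr2 -mulrA mulrC.
rewrite ltr_pM2r ?normr_gt0//.
have : `|s| < eps / (C + 1).
  by near: s; apply: dnbhs0_lt; rewrite divr_gt0// ltr_wpDl.
rewrite ltr_pdivlMr ?ltr_wpDl//; apply: le_lt_trans.
by rewrite ler_wpM2l// lerDl.
Unshelve. all: by end_near. Qed.

End QuadraticRemainder.

(** * Termwise differentiation of phrases *)

Section Series.
Variables (R : realType) (n : nat) (hn : composition R n).
Notation K := (cd R n).
Implicit Types (t : nat -> pterm R n) (a z h : K).

Lemma series_dominated (u v : R^nat) : (forall k, `|u k| <= v k) ->
  cvgn (series v) -> cvgn (series u) /\ `|limn (series u)| <= limn (series v).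
Proof.
move=> uv cv.
have cn : cvgn [normed series u].
  apply: series_le_cvg cv => [k|k|k]; first exact: normr_ge0.
    exact: le_trans (normr_ge0 _) (uv k).
  exact: uv.
split; first exact: (@normed_cvg R R^o).
exact: le_trans (@lim_series_norm R R^o u cn) (lim_series_le cn cv uv).
Qed.

Definition psum t a z : K :=
  \row_i limn (series (fun k => peval (t k) (z - a) 0 i)).

Definition msummable t (s : R) := cvgn (series (fun k => (majorant (t k)).[s])).

Lemma psum_cvg t a z s i : msummable t s -> cdabs (z - a) <= s ->
  cvgn (series (fun k => peval (t k) (z - a) 0 i)).
Proof.
move=> ht hz; apply: (series_dominated _ ht).1 => k.
exact: le_trans (cdabs_coord _ _) (peval_bound hn _ hz).
Qed.

(** Differentiation costs an arbitrarily small part of the radius, by [nnegp_deriv_le]. *)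
Lemma msummable_pder t s s' h : 0 <= s -> s < s' -> msummable t s' ->
  msummable (fun k => pder h (t k)) s.
Proof.
move=> s0 ss' ht.
have hc := @is_cvg_seriesZ R _ (cdabs h * (s' - s)^-1) ht.
apply: (series_dominated _ hc).1 => k.
rewrite majorant_pder// hornerZ ger0_norm; last first.
  by rewrite mulr_ge0 ?cdabs_ge0// nnegp_ge0//; exact/nnegp_deriv/nnegp_majorant.
rewrite -[leRHS]/(_ * (majorant (t k)).[s']) -mulrA ler_wpM2l ?cdabs_ge0//.
exact: nnegp_deriv_le (nnegp_majorant _) s0 ss'.
Qed.

(** With [c] the distance left to the radius [s], the k-th quadratic remainder is at most [x^2 |h|^2
    c^-2 (majorant (t k)).[s]], which is summable in [k]. *)
Lemma psum_derive t a z h s : msummable t s -> cdabs (z - a) < s ->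
  is_derive z h (psum t a) (psum (fun k => pder h (t k)) a z).
Proof.
move=> ht hz; apply: coord_is_derive => i.
set c := s - cdabs (z - a); have c0 : 0 < c by rewrite subr_gt0.
have hs' : msummable (fun k => pder h (t k)) (cdabs (z - a)).
  exact: msummable_pder (cdabs_ge0 _) hz ht.
have h1 : 0 < cdabs h + 1 by rewrite ltr_wpDl ?cdabs_ge0.
have -> : (fun y => psum t a y 0 i)
    = fun y => limn (series (fun k => peval (t k) (y - a) 0 i)).
  by apply/funext => y; rewrite mxE.
(* The radius keeps [|x h| <= c]; the [+ 1] avoids a division by zero when [h = 0]. *)
apply: (@quadratic_is_derive _ _ _ _ _ _
  (cdabs h ^+ 2 * c ^- 2 * limn (series (fun k => (majorant (t k)).[s]))) (c / (cdabs h + 1))).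
  exact: divr_gt0.
move=> x; rewrite ltr_pdivlMr// => xe.
have xh : cdabs (x *: h) <= c.
  by rewrite cdabsZ (le_trans _ (ltW xe))// ler_wpM2l// lerDl.
have zx : cdabs (z + x *: h - a) <= s.
  by rewrite addrAC (le_trans (cdabsD _ _))// -lerBrDl.
have cz := @psum_cvg _ _ _ _ i ht (ltW hz); have cd' := @psum_cvg _ _ _ _ i hs' (lexx _).
have czx := @psum_cvg _ _ _ _ i ht zx.
have cd : cvgn (series (x *: (fun k => peval (pder h (t k)) (z - a) 0 i))).
  exact: is_cvg_seriesZ.
have cC := @is_cvg_seriesZ R _ (x ^+ 2 * (cdabs h ^+ 2 * c ^- 2)) ht.
have -> : x ^+ 2 * (cdabs h ^+ 2 * c ^- 2 * limn (series (fun k => (majorant (t k)).[s])))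
    = limn (series ((x ^+ 2 * (cdabs h ^+ 2 * c ^- 2)) *: (fun k => (majorant (t k)).[s]))).
  by rewrite lim_seriesZ// mulrA.
have -> : x * psum (fun k => pder h (t k)) a z 0 i
    = limn (series (x *: (fun k => peval (pder h (t k)) (z - a) 0 i))).
  by rewrite lim_seriesZ// mxE.
rewrite -lim_seriesB// -lim_seriesB//; last exact: is_cvg_seriesB.
apply: (series_dominated _ cC).2 => k.
change (`|peval (t k) (z + x *: h - a) 0 i - peval (t k) (z - a) 0 i
    - x * peval (pder h (t k)) (z - a) 0 i|
  <= x ^+ 2 * (cdabs h ^+ 2 * c ^- 2) * (majorant (t k)).[s]).
have -> : (peval (t k) (z + x *: h - a) 0 i - peval (t k) (z - a) 0 i
    - x * peval (pder h (t k)) (z - a) 0 i)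
  = (peval (t k) (z - a + x *: h) - peval (t k) (z - a)
    - peval (pder (x *: h) (t k)) (z - a)) 0 i.
  have -> : z + x *: h - a = z - a + x *: h by rewrite addrAC.
  by rewrite (linZ (peval_pder_lin (t k) (z - a))) !mxE.
rewrite (le_trans (cdabs_coord _ _))//.
rewrite (le_trans (peval_rem hn _ (lexx _) (lexx _)))//.
rewrite (le_trans (taylor_rem_le (nnegp_majorant _) (cdabs_ge0 _) (cdabs_ge0 _) xh c0))//.
rewrite /c subrKC cdabsZ exprMn real_normK ?num_real// -!mulrA.
by [].
Qed.

End Series.

Lemma cvg_coord (R : realType) (N : nat) (T : Type) (F : set_system T) (u : T -> 'rV[R]_N) (l : 'rV[R]_N) i :
  Filter F -> u x @[x --> F] --> l -> u x 0 i @[x --> F] --> (l 0 i : R).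
Proof.
move=> FF ul; exact: (cvg_comp u (fun v : 'rV[R]_N => v 0 i) ul (@coord_continuous R 1 N 0 i l)).
Qed.

Lemma coord_cvg (R : realType) (N : nat) (T : Type) (F : set_system T) (u : T -> 'rV[R]_N) (l : 'rV[R]_N) :
  Filter F -> (forall i, u x 0 i @[x --> F] --> l 0 i) -> u x @[x --> F] --> l.
Proof.
move=> FF h; apply/cvgrPdist_le => e e0.
have H : \forall x \near F, forall i, `|l 0 i - u x 0 i| <= e.
  apply: filter_forall => i.
  by have /cvgrPdist_le := h i; apply.
apply: filterS H => x H; rewrite /Num.Def.normr /= mx_normrE.
apply: bigmax_le => [|[i j] _ /=]; first exact: ltW.
by rewrite (ord1 i) !mxE.
Qed.

Lemma series_coord (R : realType) (N : nat) (u : nat -> 'rV[R]_N) m i :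
  series u m 0 i = series (fun k => u k 0 i) m.
Proof. by rewrite /series /= summxE. Qed.

Section Regularity.
Variables (R : realType) (n : nat) (hn : composition R n).
Notation K := (cd R n).
Implicit Types (f : K -> K) (xi : K) (A B : K -> K).

Lemma series_psum (t : nat -> pterm R n) (a z l : K) :
  series (fun k => peval (t k) (z - a)) @ \oo --> l -> l = psum t a z.
Proof.
move=> h; apply/rowP => i; rewrite mxE.
have H : series (fun k => peval (t k) (z - a) 0 i) @ \oo --> (l 0 i : R).
  rewrite (_ : series _ = fun m => series (fun k => peval (t k) (z - a)) m 0 i).
    exact: cvg_coord h.
  by apply/funext => m; rewrite series_coord.
by apply/esym/cvg_lim => //; exact: H.
Qed.

(** Provides a point of convergence strictly farther from the centre [a] than [xi], so that [xi] is
    interior to the ball of convergence. When [xi = a], any direction leads away from it. *)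
Lemma further_point (a xi : K) (P : set K) : nbhs xi P ->
  exists2 z, P z & cdabs (xi - a) < cdabs (z - a).
Proof.
move=> /nbhs_ballP[e e0 eP].
have step (v : K) : v != 0 -> (forall s : R, 0 < s -> cdabs (xi - a) < cdabs (xi + s *: v - a)) ->
   exists2 z, P z & cdabs (xi - a) < cdabs (z - a).
  move=> v0 H; have v1 : 0 < `|v| + 1 by rewrite ltr_wpDl.
  pose s := e / (`|v| + 1); exists (xi + s *: v); last by apply: H; rewrite divr_gt0.
  apply: eP; rewrite -ball_normE /= opprD addNKr normrN normrZ gtr0_norm ?divr_gt0//.
  by rewrite mulrAC ltr_pdivrMr// ltr_pM2l// ltrDl.
have [x0|x0] := eqVneq (xi - a) 0.
  apply: (step (cdone R n)) => [|s s0].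
    by rewrite -dot_eq0 dot11 oner_eq0.
  rewrite addrAC x0 cdabs0 add0r cdabsZ mulr_gt0 ?normr_gt0 ?gt_eqF//.
  by rewrite cdabsE dot11 sqrtr1.
apply: (step (xi - a)) => // s s0.
have -> : xi + s *: (xi - a) - a = (1 + s) *: (xi - a).
  by rewrite addrAC scalerDl scale1r.
rewrite cdabsZ gtr0_norm ?addr_gt0// ltr_pMl ?cdabs_gt0//.
by rewrite ltrDl.
Qed.

Lemma superderivatives_psum f xi A B : superderivatives f xi A B ->
  exists (a : K) (t : nat -> pterm R n) (s : R),
  [/\ cdabs (xi - a) < s, msummable t s,
      \forall z \near xi, f z = psum t a z &
      forall h, A h + B h = psum (fun k => pder h (t k)) a xi].
Proof.
move=> [a [w [Hf HA HB]]].
have [z1 [c1 _] z1a] := further_point a Hf.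
exists a, (fun k => pterm_of_word (w k)), (cdabs (z1 - a)); split => //.
- rewrite /msummable; suff -> : (fun k => (majorant (pterm_of_word (w k))).[cdabs (z1 - a)])
      = (fun k => cdabs (weval (w k) (z1 - a))) by [].
  by apply/funext => k; rewrite majorant_word.
- apply: filterS Hf => z [_ Hz]; apply: series_psum.
  by under eq_fun do rewrite peval_word.
- move=> h; apply: series_psum.
  under eq_fun do rewrite peval_pder_word.
  rewrite (_ : series _ = series (fun k => wdz (w k) (xi - a) h)
     + series (fun k => wdzbar (w k) (xi - a) h)); last by rewrite -seriesD.
  exact: cvgD.
Qed.

Lemma psum_lin (t : K -> nat -> pterm R n) a z s : 
  (forall h, msummable (t h) s) -> cdabs (z - a) <= s ->
  (forall k, lin (fun h => peval (t h k) (z - a))) ->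
  lin (fun h => psum (t h) a z).
Proof.
move=> ht hz hl c u v; apply/rowP => i; rewrite !mxE.
have cc h := @psum_cvg _ _ hn _ a z s i (ht h) hz.
rewrite -[c * _](lim_seriesZ c (cc u)) -lim_seriesD//; last exact: is_cvg_seriesZ.
congr (limn (series _)); apply/funext => k.
by rewrite hl !mxE.
Qed.

Definition smooth3 (U : set K) f (f1 : K -> K -> K) (f2 : K -> K -> K -> K) (f3 : K -> K -> K -> K -> K) :=
  [/\ forall x h, U x -> is_derive x h f (f1 x h),
      forall x h k, U x -> is_derive x k (f1^~ h) (f2 x h k) &
      forall x h k l, U x -> is_derive x l (fun y => f2 y h k) (f3 x h k l)] /\
  [/\ forall x h k, U x -> f2 x h k = f2 x k h,
      forall x h k l, U x -> f3 x h k l = f3 x h l k,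
      forall x, U x -> lin (f1 x) &
      forall x h, U x -> lin (f2 x h)].

Lemma psum_smooth3 (a : K) (t : nat -> pterm R n) s : msummable t s ->
  smooth3 [set z | cdabs (z - a) < s] (psum t a)
    (fun z h => psum (fun k => pder h (t k)) a z)
    (fun z h k => psum (fun j => pder k (pder h (t j))) a z)
    (fun z h k l => psum (fun j => pder l (pder k (pder h (t j)))) a z).
Proof.
move=> ht.
have mid (u v : R) : 0 <= u -> u < v -> [/\ u < (u + v) / 2, 0 <= (u + v) / 2 & (u + v) / 2 < v].
  by move=> u0 uv; split; lra.
(* Every differentiation halves the margin between [|z - a|] and the radius, and a positive margin
   remains. *)
have S1 z : cdabs (z - a) < s -> exists2 s', cdabs (z - a) < s' &
    forall h, msummable (fun k => pder h (t k)) s'.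
  move=> /(mid _ _ (cdabs_ge0 _))[lo ge hi]; exists ((cdabs (z - a) + s) / 2) => // h.
  exact: msummable_pder ge hi ht.
have S2 z : cdabs (z - a) < s -> exists2 s', cdabs (z - a) < s' &
    forall h k, msummable (fun j => pder k (pder h (t j))) s'.
  move=> /S1[s1 zs hs1]; have [lo ge hi] := mid _ _ (cdabs_ge0 _) zs.
  exists ((cdabs (z - a) + s1) / 2) => // h k.
  exact: msummable_pder ge hi (hs1 h).
split; split => /=.
- by move=> z h zs; exact: psum_derive zs.
- by move=> z h k /S1[s1 zs hs1]; exact: psum_derive zs.
- by move=> z h k l /S2[s2 zs hs2]; exact: psum_derive zs.
- move=> z h k zs; apply/rowP => i; rewrite !mxE; congr (limn (series _)).
  by apply/funext => j; rewrite peval_pder_sym.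
- move=> z h k l zs; apply/rowP => i; rewrite !mxE; congr (limn (series _)).
  by apply/funext => j; rewrite peval_pder_sym.
- move=> z /S1[s1 zs hs1]; apply: psum_lin (ltW zs) _ => // k.
  exact: peval_pder_lin.
- move=> z h /S2[s2 zs hs2]; apply: psum_lin (ltW zs) _ => // k.
  exact: peval_pder_lin.
Qed.

Lemma superderivatives_is_derive f xi A B h : superderivatives f xi A B ->
  is_derive xi h f (A h + B h).
Proof.
move=> /superderivatives_psum[a [t [s [xs ht hf ->]]]].
have [->|h0] := eqVneq h 0.
  have [[_ _ _] [_ _ + _]] := psum_smooth3 a ht.
  move=> /(_ xi xs)/lin0 ->; exact: is_derive0.
have [[+ _ _] _] := psum_smooth3 a ht; move=> /(_ xi h xs).
by apply: near_eq_is_derive => //; apply: filterS hf => z ->.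
Qed.

(** Each point comes with its own phrase, so higher derivatives are first obtained near each point.
    They are glued by taking directional derivatives as global definitions, which agree with every
    local choice. *)
Lemma superderivatives_smooth f (D : K -> K -> K) (U : set K) : open U ->
  (forall xi, U xi -> superderivatives f xi (D xi) (fun=> 0)) ->
  exists (f2 : K -> K -> K -> K) (f3 : K -> K -> K -> K -> K), smooth3 U f D f2 f3.
Proof.
move=> oU HD.
have d0 x h : U x -> is_derive x h f (D x h).
  by move=> /HD/(superderivatives_is_derive h); rewrite addr0.
have loc x : U x -> exists (O : set K) (f2 : K -> K -> K -> K)
    (f3 : K -> K -> K -> K -> K), [/\ open O, O x, O `<=` U & smooth3 O f D f2 f3].
  move=> Ux; have [a [t [s [xs ht hf _]]]] := superderivatives_psum (HD x Ux).
  have [[e0 e1 e2] [s2 s3 l1 l2]] := psum_smooth3 a ht.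
  set f1 := (fun z h => psum (fun k => pder h (t k)) a z) in e0 e1 l1.
  set f2 := (fun z h k => psum (fun j => pder k (pder h (t j))) a z) in e1 e2 s2 l2.
  set f3 := (fun z h k l => psum (fun j => pder l (pder k (pder h (t j)))) a z) in e2 s3.
  pose P := [set z | cdabs (z - a) < s] `&` [set z | f z = psum t a z] `&` U.
  pose O := interior P.
  have OP : O `<=` P := @interior_subset _ _.
  have oO : open O := @open_interior _ _.
  (* [D z] comes from another phrase, centred elsewhere, but both compute the directional derivative
     of [f] at [z]. *)
  have DE z h : O z -> D z h = f1 z h.
    move=> Oz; have [[/= zs _] Uz] := OP z Oz.
    apply: (is_derive_unique (d0 z h Uz)).
    apply: (is_derive_open oO Oz) (e0 z h zs).
    by move=> y /OP[[_ ->] _].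
  exists O, f2, f3; split.
  - exact: oO.
  - apply: filterI; first apply: filterI.
    + exact: cdabs_near.
    + exact: hf.
    + exact: open_nbhs_nbhs (conj oU Ux).
  - by move=> z /OP[].
  - split; split.
    + by move=> z h /OP[_ Uz]; exact: d0.
    + move=> z h k Oz; have [[/= zs _] _] := OP z Oz.
      apply: (is_derive_open oO Oz) (e1 z h k zs).
      by move=> y Oy; rewrite DE.
    + by move=> z h k l /OP[[/= zs _] _]; exact: e2.
    + by move=> z h k /OP[[/= zs _] _]; exact: s2.
    + by move=> z h k l /OP[[/= zs _] _]; exact: s3.
    + move=> z Oz; have [[/= zs _] _] := OP z Oz.
      have -> : D z = f1 z by apply/funext => h; exact: DE.
      exact: l1.
    + by move=> z h /OP[[/= zs _] _]; exact: l2.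
pose f2 x h k := 'D_k (D^~ h) x.
pose f3 x h k l := 'D_l (fun y => f2 y h k) x.
exists f2, f3.
have {loc} loc x : U x -> exists (O : set K) (g2 : K -> K -> K -> K)
    (g3 : K -> K -> K -> K -> K), [/\ open O, O x, smooth3 O f D g2 g3,
    forall y h k, O y -> f2 y h k = g2 y h k &
    forall y h k l, O y -> f3 y h k l = g3 y h k l].
  move=> /loc [Q [g2 [g3 [oQ Qx QU Sm]]]]; exists Q, g2, g3.
  have [[e0 e1 e2] _] := Sm.
  have E2 y h k : Q y -> f2 y h k = g2 y h k.
    by move=> Qy; case: (e1 y h k Qy).
  split; [exact: oQ|exact: Qx|exact: Sm|exact: E2|].
  move=> y h k l Qy; rewrite /f3.
  have : is_derive y l (fun y => f2 y h k) (g3 y h k l).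
    by apply: (is_derive_open oQ Qy) (e2 y h k l Qy) => u Qu; rewrite E2.
  by case.
split; split; first exact: d0.
- move=> x h k /loc [Q [g2 [g3 [oQ Qx [[e0 e1 e2] _] E2 E3]]]].
  by rewrite E2//; exact: e1.
- move=> x h k l /loc [Q [g2 [g3 [oQ Qx [[e0 e1 e2] _] E2 E3]]]].
  rewrite E3//; apply: (is_derive_open oQ Qx) (e2 x h k l Qx) => y Qy.
  by rewrite E2.
- move=> x h k /loc [Q [g2 [g3 [oQ Qx [_ [s2 s3 l1 l2]] E2 E3]]]].
  by rewrite !E2// s2.
- move=> x h k l /loc [Q [g2 [g3 [oQ Qx [_ [s2 s3 l1 l2]] E2 E3]]]].
  by rewrite !E3// s3.
- by move=> x /loc [Q [g2 [g3 [oQ Qx [_ [s2 s3 l1 l2]] E2 E3]]]]; exact: l1.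
- move=> x h /loc [Q [g2 [g3 [oQ Qx [_ [s2 s3 l1 l2]] E2 E3]]]].
  have -> : f2 x h = g2 x h by apply/funext => k; exact: E2.
  exact: l2.
Qed.

End Regularity.

Section Pseudoconformal.
Variables (R : realType) (n : nat).
Notation K := (cd R n).

Definition angle_preserving (A : K -> K) := forall h1 h2 : K,
  cdre (cdmul (A h1) (cdconj (A h2))) * cdabs h1 * cdabs h2
  = cdabs (A h1) * cdabs (A h2) * cdre (cdmul h1 (cdconj h2)).

(** A linear map that preserves orthogonality is a similarity: [h + |h| e] and [h - |h| e] are
    orthogonal, hence so are their images, and [|A h| = |A e| |h|]. *)
Lemma angle_preserving_conformal (A : K -> K) : lin A -> angle_preserving A ->
  (exists h, A h != 0) ->
  exists2 c : R, 0 < c & forall h k, dot (A h) (A k) = c * dot h k.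
Proof.
move=> lA hA [h0 Ah0].
have orth u v : dot u v = 0 -> dot (A u) (A v) = 0.
  move=> uv; have := hA u v; rewrite !cdre_dot uv mulr0 -mulrA => /eqP.
  rewrite mulf_eq0 => /orP[/eqP//|]; rewrite mulf_eq0 !cdabs_eq0.
  by case/orP => /eqP ->; rewrite (lin0 lA) ?dot0l ?dot0r.
pose e := cdone R n; have ee : dot e e = 1 by exact: dot11.
pose c := dot (A e) (A e).
have sq h : dot (A h) (A h) = c * dot h h.
  have E : dot (h + cdabs h *: e) (h - cdabs h *: e) = 0.
    by rewrite !dotE (dotC h e) ee -cdabs_sqr; ring.
  have := orth _ _ E; rewrite (linB lA) (linD lA) (linZ lA) !dotE -/c.
  by rewrite (dotC (A h) (A e)) -(cdabs_sqr h); lra.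
have pol h k : dot (A h) (A k) = c * dot h k.
  have := sq (h + k); rewrite (linD lA) !dotE !sq (dotC k h) (dotC (A k)); lra.
exists c => //; rewrite lt0r dot_ge0 andbT; apply: contra_neq Ah0 => c0.
by apply/eqP; rewrite -dot_eq0 pol c0 mul0r.
Qed.

Lemma conformal_angle_preserving (A : K -> K) (c : R) : 0 < c ->
  (forall h k, dot (A h) (A k) = c * dot h k) -> angle_preserving A.
Proof.
move=> c0 hA h k; rewrite !cdre_dot hA.
have E u : cdabs (A u) = Num.sqrt c * cdabs u.
  by rewrite cdabsE hA sqrtrM ?(ltW c0)// -cdabsE.
rewrite !E; have := sqr_sqrtr (ltW c0); rewrite expr2 => {1}<-; ring.
Qed.

Theorem pseudoconformal_liouville (f : K -> K) (D : K -> K -> K) (U : set K) :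
  composition R n -> (2 < cdim n)%N -> open U -> connected U -> U !=set0 ->
  pseudoconformal_on f D U ->
  exists (q : K) (M : 'M[R]_(cdim n)),
  conformal_mx M /\
  ((forall x, U x -> f x = q + x *m M /\ forall h, D x h = h *m M) \/
   (exists p : K, forall x, U x ->
    [/\ x != p, f x = q + sinv (x - p) *m M &
        forall h, D x h = dsinv (x - p) h *m M])).
Proof.
move=> hn hN oU cU U0 hf.
have [|f2 [f3 [[d0 d1 d2] [s2 s3 l1 l2]]]] := superderivatives_smooth hn (f := f) (D := D) oU.
  by move=> x /hf[].
apply: (liouville hN oU cU U0 d0 d1 d2 s2 s3 l1 l2) => x Ux.
have [_ h2 h3 _] := hf x Ux.
exact: angle_preserving_conformal (l1 x Ux) h2 h3.
Qed.

End Pseudoconformal.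

(** * Phrases of Moebius maps *)

Section Interleave.

(** Words have no addition, so the sum of two phrases is formed by merging their sequences of
    words. *)
Definition interleave (T : Type) (u v : nat -> T) (k : nat) : T :=
  if odd k then v k./2 else u k./2.

Lemma interleaveE (T S : Type) (F : T -> S) (u v : nat -> T) :
  (fun k => F (interleave u v k)) = interleave (F \o u) (F \o v).
Proof. by apply/funext => k; rewrite /interleave; case: odd. Qed.

(** Even indices belong to [u], which therefore holds the extra term when [m] is odd. *)
Lemma series_interleave (V : zmodType) (u v : nat -> V) m :
  series (interleave u v) m = series u (uphalf m) + series v m./2.
Proof.
elim: m => [|m IH]; first by rewrite /series /= !big_geq// addr0.
rewrite seriesSr IH /interleave [uphalf m.+1]/= [m.+1./2]/= uphalf_half.
case: odd => /=; rewrite ?add1n ?add0n.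
  by rewrite (seriesSr v) addrA.
by rewrite (seriesSr u) addrAC.
Qed.

Lemma cvg_half : half @ \oo --> \oo.
Proof.
move=> P [N _ NP]; exists N.*2 => // m /= Nm; apply: NP => /=.
by rewrite -(doubleK N) half_leq.
Qed.

Lemma cvg_uphalf : uphalf @ \oo --> \oo.
Proof.
move=> P [N _ NP]; exists N.*2 => // m /= Nm; apply: NP => /=.
by rewrite -(doubleK N) uphalf_half (leq_trans (half_leq Nm))// leq_addl.
Qed.

Lemma cvg_series_interleave (R : realType) (V : normedModType R) (u v : nat -> V) a b :
  series u @ \oo --> a -> series v @ \oo --> b ->
  series (interleave u v) @ \oo --> a + b.
Proof.
move=> ha hb.
rewrite (_ : series _ = (series u \o uphalf) + (series v \o half)); last first.
  by apply/funext => m; exact: series_interleave.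
by apply: cvgD; [exact: cvg_comp cvg_uphalf ha|exact: cvg_comp cvg_half hb].
Qed.

Lemma cvg_series_at (R : realType) (V : normedModType R) (j : nat) (c : V) :
  series (fun k => if k == j then c else 0) @ \oo --> c.
Proof.
apply: cvg_near_cst; exists j.+1 => // m /= jm.
rewrite /series /= (bigD1_seq j) ?mem_index_iota ?iota_uniq//= eqxx big1 ?addr0//.
by move=> i /negbTE ->.
Qed.

End Interleave.

Section Holo.
Variables (R : realType) (n : nat) (hn : composition R n).
Notation K := (cd R n).
Implicit Types (f g A B : K -> K) (xi c z h : K).

(* A phrase in z - xi whose terms all have a zero z~-derivative at xi.  Nothing
   is lost: z~ is the phrase (2 - N)^-1 sum_e (e z) e over the canonical basis,
   so that every R-linear map is a phrase in z alone. *)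
Definition phrase_at f xi A := exists w : nat -> word R n,
  [/\ \forall z \near xi,
        cvgn (series (fun k => cdabs (weval (w k) (z - xi)))) /\
        series (fun k => weval (w k) (z - xi)) @ \oo --> f z,
      forall h, series (fun k => wdz (w k) 0 h) @ \oo --> A h &
      forall k h, wdzbar (w k) 0 h = 0].

Lemma nbhsS2 xi (P Q S : set K) : (forall z, P z -> Q z -> S z) ->
  nbhs xi P -> nbhs xi Q -> nbhs xi S.
Proof. exact: filterS2. Qed.

Lemma nbhsW xi (P : set K) : (forall z, P z) -> nbhs xi P.
Proof. by move=> h; apply: filterS (filterT : nbhs xi setT) => z _. Qed.

Lemma phrase_superderivatives f xi A : phrase_at f xi A ->
  superderivatives f xi A (fun=> 0).
Proof.
move=> [w [H1 H2 H3]]; exists xi, w; split => //= h; rewrite subrr; first exact: H2.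
under eq_fun do rewrite H3.
by rewrite (_ : series _ = fun=> 0); [exact: cvg_cst|apply/funext => m; rewrite /series /= big1].
Qed.

Lemma phrase_eq f g xi A B : (forall z, f z = g z) -> (forall h, A h = B h) ->
  phrase_at f xi A -> phrase_at g xi B.
Proof. by move=> /funext -> /funext ->. Qed.

Lemma phrase_word (w : word R n) xi : (forall h, wdzbar w 0 h = 0) ->
  phrase_at (fun z => weval w (z - xi)) xi (wdz w 0).
Proof.
move=> hw; exists (fun k => if k == 0%N then w else WConst 0); split.
- apply: nbhsW => z; split.
    rewrite (_ : (fun k => _) = fun k : nat => if k == 0 then cdabs (weval w (z - xi)) else 0).
      apply/cvg_ex; exists (cdabs (weval w (z - xi))).
      exact: (@cvg_series_at R R^o).
    by apply/funext => k; case: eqP => //= _; rewrite cdabs0.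
  rewrite (_ : (fun k => _) = fun k : nat => if k == 0 then weval w (z - xi) else 0).
    exact: cvg_series_at.
  by apply/funext => k; case: eqP.
- move=> h; rewrite (_ : (fun k => _) = fun k : nat => if k == 0 then wdz w 0 h else 0).
    exact: cvg_series_at.
  by apply/funext => k; case: eqP.
- by move=> k h; case: eqP.
Qed.

Lemma phrase_const c xi : phrase_at (fun=> c) xi (fun=> 0).
Proof. exact: (@phrase_word (WConst c)). Qed.

Lemma phraseD f g xi A B : phrase_at f xi A -> phrase_at g xi B ->
  phrase_at (fun z => f z + g z) xi (fun h => A h + B h).
Proof.
move=> [u [H1 H2 H3]] [v [G1 G2 G3]]; exists (interleave u v); split.
- apply: nbhsS2 H1 G1 => z [cu uf] [cv vg]; split.
    rewrite (interleaveE (fun w => cdabs (weval w (z - xi)))).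
    apply/cvg_ex; eexists; exact: (@cvg_series_interleave R R^o _ _ _ _ cu cv).
  by rewrite (interleaveE (fun w => weval w (z - xi))); exact: cvg_series_interleave.
- by move=> h; rewrite (interleaveE (fun w => wdz w 0 h)); exact: cvg_series_interleave (H2 h) (G2 h).
- by move=> k h; rewrite /interleave; case: odd.
Qed.

Lemma cvg_lin (g : K -> K) (T : Type) (F : set_system T) (u : T -> K) (l : K) :
  Filter F -> lin g -> u x @[x --> F] --> l -> g (u x) @[x --> F] --> g l.
Proof.
move=> FF lg ul; apply: coord_cvg => i.
rewrite (lin_sum lg l) summxE (_ : (fun x => _) = fun x => \sum_j u x 0 j * g (ev R j) 0 i).
  apply: cvg_big => [|j _]; first exact: add_continuous.
  rewrite mxE; apply: cvgM; last exact: cvg_cst.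
  exact: cvg_coord.
by apply/funext => x; rewrite (lin_sum lg (u x)) summxE; apply: eq_bigr => j _; rewrite mxE.
Qed.

Lemma series_lin (g : K -> K) (u : nat -> K) : lin g ->
  series (fun k => g (u k)) = g \o series u.
Proof.
by move=> lg; apply/funext => m; rewrite /series /= (big_morph g (linD lg) (lin0 lg)).
Qed.

Lemma lin_mull c : lin (cdmul c).
Proof. by move=> a u v; have [_ ->] := cdmulP a u v c. Qed.

Lemma lin_mulr c : lin (fun x => cdmul x c).
Proof. by move=> a u v; have [-> _] := cdmulP a u v c. Qed.

Lemma phraseMl c f xi A : phrase_at f xi A ->
  phrase_at (fun z => cdmul c (f z)) xi (fun h => cdmul c (A h)).
Proof.
move=> [w [H1 H2 H3]]; exists (fun k => WMul (WConst c) (w k)); split.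
- apply: filterS H1 => z [cw wf]; split.
    rewrite (_ : (fun k => _) = cdabs c *: (fun k => cdabs (weval (w k) (z - xi)))).
      exact: is_cvg_seriesZ.
    by apply/funext => k; rewrite /= cdabsM.
  by rewrite (series_lin _ (lin_mull c)); apply: cvg_lin => //; exact: lin_mull.
- move=> h; rewrite (_ : (fun k => _) = fun k => cdmul c (wdz (w k) 0 h)).
    by rewrite (series_lin _ (lin_mull c)); apply: cvg_lin => //; exact: lin_mull.
  by apply/funext => k /=; rewrite cdmul0l add0r.
- by move=> k h /=; rewrite H3 cdmul0l cdmul0r addr0.
Qed.

Lemma phraseMr c f xi A : phrase_at f xi A ->
  phrase_at (fun z => cdmul (f z) c) xi (fun h => cdmul (A h) c).
Proof.
move=> [w [H1 H2 H3]]; exists (fun k => WMul (w k) (WConst c)); split.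
- apply: filterS H1 => z [cw wf]; split.
    rewrite (_ : (fun k => _) = cdabs c *: (fun k => cdabs (weval (w k) (z - xi)))).
      exact: is_cvg_seriesZ.
    by apply/funext => k; rewrite /= cdabsM//; exact: mulrC.
  by rewrite (series_lin _ (lin_mulr c)); apply: cvg_lin => //; exact: lin_mulr.
- move=> h; rewrite (_ : (fun k => _) = fun k => cdmul (wdz (w k) 0 h) c).
    by rewrite (series_lin _ (lin_mulr c)); apply: cvg_lin => //; exact: lin_mulr.
  by apply/funext => k /=; rewrite cdmul0r addr0.
- by move=> k h /=; rewrite H3 cdmul0l cdmul0r addr0.
Qed.

Lemma phraseZ a f xi A : phrase_at f xi A ->
  phrase_at (fun z => a *: f z) xi (fun h => a *: A h).
Proof.
by move/(phraseMl (a *: cdone R n)); apply: phrase_eq => z; rewrite cdmulZl cdmul1l.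
Qed.

Lemma phrase_sum m (F : 'I_m -> K -> K) xi (A : 'I_m -> K -> K) :
  (forall i, phrase_at (F i) xi (A i)) ->
  phrase_at (fun z => \sum_i F i z) xi (fun h => \sum_i A i h).
Proof.
elim: m F A => [|m IH] F A H.
  by apply: phrase_eq (phrase_const 0 xi) => z; rewrite big_ord0.
apply: phrase_eq (phraseD (H ord0) (IH _ _ (fun i => H (lift ord0 i)))) => z;
  by rewrite big_ord_recl.
Qed.

Lemma phrase_id xi : phrase_at id xi id.
Proof.
have := phraseD (phrase_const xi xi) (@phrase_word (WVar R n) xi (fun=> erefl)).
by apply: phrase_eq => z /=; rewrite ?add0r// addrC subrK.
Qed.

Hypothesis dim2 : (2 < cdim n)%N.

Lemma phrase_conj f xi A : phrase_at f xi A ->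
  phrase_at (fun z => cdconj (f z)) xi (fun h => cdconj (A h)).
Proof.
move=> H; have d0 : 2 - (cdim n)%:R != 0 :> R.
  by rewrite subr_eq0 eqr_nat neq_ltn dim2.
have := phraseZ (2 - (cdim n)%:R)^-1
  (phrase_sum (fun i => phraseMr (ev R i) (phraseMl (ev R i) H))).
by apply: phrase_eq => z; rewrite sum_mul_ev// scalerA mulVf// scale1r.
Qed.

(** The [i]-th coordinate of [w] is [Re (w e_i~)], and [2 Re w = w + w~]. *)
Lemma phrase_coord f xi A i c : phrase_at f xi A ->
  phrase_at (fun z => f z 0 i *: c) xi (fun h => A h 0 i *: c).
Proof.
move=> /(phraseMr (cdconj (ev R i))) H.
have := phraseMr c (phraseZ (2^-1) (phraseD H (phrase_conj H))).
apply: phrase_eq => z; rewrite (cdconjE (cdmul _ _)) cdre_dot dot_evr addrC subrK;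
  by rewrite scalerA mulKf// cdmulZl cdmul1l.
Qed.

Lemma phrase_mx f xi A (M : 'M[R]_(cdim n)) : phrase_at f xi A ->
  phrase_at (fun z => f z *m M) xi (fun h => A h *m M).
Proof.
move=> H; have := phrase_sum (fun i => phrase_coord i (row i M) H).
by apply: phrase_eq => z; rewrite mulmx_sum_row.
Qed.

End Holo.

(** * The geometric series and the phrase of the inversion *)

Section Geometric.
Variables (R : realType) (n : nat) (hn : composition R n).
Notation K := (cd R n).
Implicit Types (b v z h xi : K).

(** The power [(z b)^k], bracketed to the right so that multiplication by [1 - z b] on the left
    telescopes. *)
Fixpoint wpow b (k : nat) : word R n :=
  if k is k'.+1 then WMul (WMul (WVar R n) (WConst b)) (wpow b k')
  else WConst (cdone R n).

(** The inverse of [1 - v], as its conjugate divided by its squared norm. *)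
Definition geom v : K :=
  (dot (cdone R n - v) (cdone R n - v))^-1 *: cdconj (cdone R n - v).

Lemma cdabs_wpow b k z : cdabs (weval (wpow b k) z) = cdabs (cdmul z b) ^+ k.
Proof.
elim: k => [|k IH] /=; first by rewrite cdabsE dot11 sqrtr1.
by rewrite cdabsM// IH exprS.
Qed.

Lemma wdzbar_wpow b k z h : wdzbar (wpow b k) z h = 0.
Proof. by elim: k => //= k IH; rewrite IH !(cdmul0l, cdmul0r, addr0). Qed.

Lemma wdz_wpow b k h : wdz (wpow b k) 0 h = if k == 1%N then cdmul h b else 0.
Proof.
case: k => [|[|k]] //=; first by rewrite !(cdmul0l, cdmul0r, addr0) cdmul1r.
by rewrite !(cdmul0l, cdmul0r, addr0).
Qed.

Lemma one_sub_neq0 v : cdabs v < 1 -> dot (cdone R n - v) (cdone R n - v) != 0.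
Proof.
move=> v1; rewrite dot_eq0 subr_eq0; apply/eqP => E.
by move: v1; rewrite -E cdabsE dot11 sqrtr1 ltxx.
Qed.

Lemma cvg_cd0 (u : nat -> K) (x C : R) : 0 <= x < 1 -> (forall m, cdabs (u m) <= C * x ^+ m) ->
  u @ \oo --> (0 : K).
Proof.
move=> /andP[x0 x1] H; apply: coord_cvg => i; rewrite mxE.
have L : (fun m => C * x ^+ m) @ \oo --> (0 : R).
  rewrite -(mulr0 C); apply: cvgM; first exact: cvg_cst.
  by apply: cvg_expr; rewrite ger0_norm.
apply: norm_cvg0; apply: squeeze_cvgr (cvg_cst 0) L.
by apply: nearW => m; rewrite normr_ge0 (le_trans (cdabs_coord _ _)).
Qed.

(** [1 - v] times a partial sum telescopes to [1 - W m]. The factor [1 - v] is then removed by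
    [cdmul_conjK], which does not use associativity. *)
Lemma series_wpow b z : cdabs (cdmul z b) < 1 ->
  series (fun k => weval (wpow b k) z) @ \oo --> geom (cdmul z b).
Proof.
set v := cdmul z b => v1; have d0 := one_sub_neq0 v1.
set d := dot _ _ in d0; set W := fun k => weval (wpow b k) z.
have E m : cdmul (cdone R n - v) (series W m) = cdone R n - W m.
  elim: m => [|m IH]; first by rewrite /series /= big_geq// cdmul0r subrr.
  rewrite seriesSr cdmulDr IH cdmulDl cdmul1l cdmulNl.
  by rewrite addrA subrK.
have S m : series W m = geom v - d^-1 *: cdmul (cdconj (cdone R n - v)) (W m).
  apply: (scalerI d0); rewrite -cdmul_conjK// E cdmulDr cdmul1r cdmulNr.
  by rewrite scalerBr /geom !scalerA -/d mulfV// !scale1r.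
rewrite (_ : series W = fun m => geom v - d^-1 *: cdmul (cdconj (cdone R n - v)) (W m)); last first.
  by apply/funext.
rewrite -[X in _ --> X]subr0; apply: cvgB; first exact: cvg_cst.
apply: (@cvg_cd0 _ (cdabs v) (`|d^-1| * cdabs (cdconj (cdone R n - v)))).
  by rewrite cdabs_ge0.
by move=> m; rewrite cdabsZ cdabsM// cdabs_wpow mulrA.
Qed.

Lemma phrase_geom b xi :
  phrase_at (fun z => geom (cdmul (z - xi) b)) xi (fun h => cdmul h b).
Proof.
exists (wpow b); split.
- have H : nbhs xi [set z | cdabs (z - xi) < (cdabs b + 1)^-1].
    by apply: cdabs_near; rewrite subrr cdabs0 invr_gt0 ltr_wpDl ?cdabs_ge0.
  apply: filterS H => z /= H.
  have v1 : cdabs (cdmul (z - xi) b) < 1.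
    rewrite cdabsM// (le_lt_trans (y := cdabs (z - xi) * (cdabs b + 1)))//.
      by rewrite ler_wpM2l ?cdabs_ge0// lerDl.
    by rewrite -ltr_pdivlMr ?div1r// ltr_wpDl ?cdabs_ge0.
  split; last exact: series_wpow.
  under eq_fun do rewrite cdabs_wpow.
  have := @is_cvg_geometric_series R 1 (cdabs (cdmul (z - xi) b)).
  rewrite ger0_norm ?cdabs_ge0// => /(_ v1).
  by congr (cvgn (series _)); apply/funext => k; rewrite /geometric /= mul1r.
- move=> h; under eq_fun do rewrite wdz_wpow.
  exact: cvg_series_at.
- by move=> k h; exact: wdzbar_wpow.
Qed.

Hypothesis dim2 : (2 < cdim n)%N.

(* With eta := xi - p, z - p = (1 + (z - xi) eta^-1) eta, so that the inverse of
   z - p is given by a geometric series around xi. *)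
Lemma phrase_sinv (p xi : K) : xi != p ->
  phrase_at (fun z => sinv (z - p)) xi (dsinv (xi - p)).
Proof.
rewrite -subr_eq0; set y := xi - p => y0.
have d0 : dot y y != 0 by rewrite dot_eq0.
pose b := - ((dot y y)^-1 *: cdconj y).
have fac z : cdmul (cdone R n - cdmul (z - xi) b) y = z - p.
  rewrite /b cdmulNr opprK cdmulDl cdmul1l cdmulZr cdmulZl.
  have := cdmulK_conj hn (cdconj y) (z - xi); rewrite cdconjK dot_conj => ->.
  by rewrite scalerA mulVf// scale1r addrC subrKA.
(* [sinv w] is the conjugate of [w^-1], whence the conjugated geometric series. *)
have := phraseZ hn (dot y y)^-1 (phraseMr hn y (phrase_conj hn dim2 (phrase_geom b xi))).
apply: phrase_eq => [z|h].
  rewrite /geom cdconjZ cdconjK cdmulZl fac scalerA /sinv; congr (_ *: _).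
  by rewrite -(fac z) hn invfM mulrC.
(* The derivative is [- |y|^-4 (y h~) y], which [mul_mul_self] turns into [dsinv y h]. *)
rewrite /b cdmulNr cdconjN cdmulZr cdconjZ cdconjM cdconjK cdmulNl cdmulZl.
rewrite mul_mul_self// cdconjK /dsinv.
apply/rowP => j; rewrite !mxE; by field.
Qed.

End Geometric.

(** Both sides are the determinant of the block matrix with rows [1, A] and [B, 1], factored into
    triangular blocks in two ways. *)
Lemma det_sylvester (R : comUnitRingType) (m n : nat) (A : 'M[R]_(m, n)) (B : 'M[R]_(n, m)) :
  \det (1%:M - A *m B) = \det (1%:M - B *m A).
Proof.
have E1 : block_mx 1%:M A B 1%:M =
    block_mx 1%:M 0 B 1%:M *m block_mx 1%:M A 0 (1%:M - B *m A).
  by rewrite mulmx_block !mulmx1 !mul1mx !mul0mx ?mulmx0 ?addr0 ?add0r subrKC.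
have E2 : block_mx 1%:M A B 1%:M =
    block_mx (1%:M - A *m B) A 0 1%:M *m block_mx 1%:M 0 B 1%:M.
  by rewrite mulmx_block !mulmx1 !mul1mx ?mul0mx ?mulmx0 ?addr0 ?add0r subrK.
have := congr1 (fun X => \det X) (etrans (esym E1) E2).
by rewrite !det_mulmx !det_ublock !det_lblock !det1 !mulr1 !mul1r => ->.
Qed.

Section Orientation.
Variables (R : realType) (N : nat).
Notation V := 'rV[R]_N.

Lemma lin1_mxE (A : V -> V) (B : 'M[R]_N) : (forall h, A h = h *m B) -> lin1_mx A = B.
Proof. by move=> AB; apply/matrixP => i j; rewrite mxE AB -rowE mxE. Qed.

Definition dsinv_mx (y : V) : 'M[R]_N :=
  (dot y y)^-1 *: (1%:M - (2 / dot y y) *: (y^T *m y)).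

Lemma dsinv_mxE y h : dsinv y h = h *m dsinv_mx y.
Proof.
rewrite /dsinv_mx -scalemxAr mulmxBr mulmx1 -scalemxAr mulmxA.
have -> : h *m y^T = (dot h y)%:M.
  by rewrite [LHS]mx11_scalar; congr (_%:M); rewrite mxE; apply: eq_bigr => i _; rewrite mxE.
rewrite mul_scalar_mx /dsinv (dotC y h).
by apply/rowP => j; rewrite !mxE expr2 invfM; ring.
Qed.

(** A reflection is a rank-one perturbation of the identity; [det_sylvester] reduces its determinant
    to the 1 by 1 case [1 - 2 = -1]. Inversion thus reverses orientation. *)
Lemma det_dsinv_mx y : y != 0 -> \det (dsinv_mx y) < 0.
Proof.
rewrite -dot_gt0 => y0; rewrite detZ pmulr_rlt0 ?exprn_gt0 ?invr_gt0//.
rewrite scalemxAl det_sylvester -scalemxAr.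
have -> : y *m y^T = (dot y y)%:M.
  by rewrite [LHS]mx11_scalar; congr (_%:M); rewrite mxE; apply: eq_bigr => i _; rewrite mxE.
rewrite scale_scalar_mx mulfVK ?gt_eqF//.
rewrite -raddfB det_scalar1; lra.
Qed.

End Orientation.

Section Moebius.
Variables (R : realType) (n : nat) (hn : composition R n) (dim2 : (2 < cdim n)%N).
Notation K := (cd R n).
Implicit Types (p q xi : K) (M : 'M[R]_(cdim n)).

Lemma conformal_mx_neq0 M (g : K -> K) (c : R) : conformal_mx M -> 0 < c ->
  (forall h k, dot (g h) (g k) = c * dot h k) ->
  angle_preserving (fun h => g h *m M) /\ exists h, g h *m M != 0.
Proof.
move=> [d d0 dM] c0 hg.
have E h k : dot (g h *m M) (g k *m M) = (d * c) * dot h k by rewrite dM hg mulrA.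
split; first exact: conformal_angle_preserving (mulr_gt0 d0 c0) E.
by exists (cdone R n); rewrite -dot_gt0 E dot11 mulr1 mulr_gt0.
Qed.

Lemma affine_pseudoconformal q M xi : conformal_mx M -> 0 < \det M ->
  pseudoconformal_at (fun z => q + z *m M) xi (fun h => h *m M).
Proof.
move=> cM dM.
have [h2 h3] := @conformal_mx_neq0 M id 1 cM ltr01 (fun h k => esym (mul1r _)).
split => //; last by rewrite (lin1_mxE (B := M)).
apply: phrase_superderivatives.
have := phraseD (phrase_const q xi) (phrase_mx hn dim2 M (phrase_id xi)).
by apply: phrase_eq => z //; rewrite add0r.
Qed.

Lemma inversive_det p M xi : xi != p ->
  (0 < \det (lin1_mx (fun h => dsinv (xi - p) h *m M))) = (\det M < 0).
Proof.
rewrite -subr_eq0 => y0.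
rewrite (lin1_mxE (B := dsinv_mx (xi - p) *m M)); last first.
  by move=> h; rewrite dsinv_mxE mulmxA.
by rewrite det_mulmx nmulr_rgt0// det_dsinv_mx.
Qed.

Lemma inversive_pseudoconformal p q M xi : conformal_mx M -> \det M < 0 -> xi != p ->
  pseudoconformal_at (fun z => q + sinv (z - p) *m M) xi
    (fun h => dsinv (xi - p) h *m M).
Proof.
move=> cM dM xp; have y0 := xp; rewrite -subr_eq0 in y0.
have [|h2 h3] := conformal_mx_neq0 cM _ (fun h k => dsinv_dot h k y0).
  by rewrite invr_gt0 exprn_gt0// dot_gt0.
split => //; last by rewrite inversive_det.
apply: phrase_superderivatives.
have := phraseD (phrase_const q xi) (phrase_mx hn dim2 M (phrase_sinv hn dim2 xp)).
by apply: phrase_eq => z //; rewrite add0r.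
Qed.

End Moebius.

(** * Reflections *)

Section Quadrics.
Variables (R : realType) (N : nat).
Notation V := 'rV[R]_N.
Implicit Types (x y v w beta : V) (alpha gamma : R) (M : 'M[R]_N).

Definition quad alpha beta gamma x : R :=
  alpha * dot x x + 2 * dot beta x + gamma.

(* Half the gradient of the quadratic form. *)
Definition qnormal alpha beta x : V := alpha *: x + beta.

(* The common expression of the reflection in a hyperplane and of the
   inversion in a sphere given by the equation quad = 0. *)
Definition qrefl alpha beta gamma x : V :=
  let v := qnormal alpha beta x in x - (quad alpha beta gamma x / dot v v) *: v.

(** On the quadric, the squared normal is the discriminant [|beta|^2 - alpha gamma]; its positivity
    makes the quadric nonsingular. *)
Lemma dot_qnormal alpha beta gamma x :
  dot (qnormal alpha beta x) (qnormal alpha beta x)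
  = alpha * quad alpha beta gamma x + (dot beta beta - alpha * gamma).
Proof. by rewrite /qnormal /quad !dotE (dotC x beta); ring. Qed.

Lemma qreflZ k alpha beta gamma x : k != 0 ->
  qrefl (k * alpha) (k *: beta) (k * gamma) x = qrefl alpha beta gamma x.
Proof.
move=> k0; rewrite /qrefl.
have -> : qnormal (k * alpha) (k *: beta) x = k *: qnormal alpha beta x.
  by rewrite /qnormal scalerDr scalerA.
have -> : quad (k * alpha) (k *: beta) (k * gamma) x = k * quad alpha beta gamma x.
  by rewrite /quad !dotE; ring.
move: (qnormal _ _ _) => v; rewrite scalerA; congr (_ - _ *: _).
rewrite dotZl dotZr; have [->|v0] := eqVneq (dot v v) 0; first by rewrite !mulr0 invr0 !mulr0 mul0r.
by field; rewrite v0.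
Qed.

Lemma conformal_mxC M c : c != 0 ->
  (forall h k : V, dot (h *m M) (k *m M) = c * dot h k) ->
  forall y : V, y *m M^T *m M = c *: y.
Proof.
move=> c0 hM.
have E y : y *m M *m M^T = c *: y.
  apply: dotP => z; rewrite dot_mulmx trmxK hM dotZl//.
have : M *m (c^-1 *: M^T) = 1%:M.
  apply/row_matrixP => i; rewrite -scalemxAr -[LHS]/(row i _) row1 rowE.
  by rewrite -scalemxAr mulmxA E scalerA mulVf// scale1r.
move/mulmx1C => H y; rewrite -{2}[y]mulmx1 -H -scalemxAl -scalemxAr scalerA.
by rewrite mulfV// scale1r mulmxA.
Qed.

Lemma quad_affine M c q alpha beta gamma x : 
  (forall h k : V, dot (h *m M) (k *m M) = c * dot h k) ->
  quad alpha beta gamma (q + x *m M)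
  = quad (c * alpha) ((alpha *: q + beta) *m M^T) (quad alpha beta gamma q) x.
Proof.
move=> hM; rewrite /quad dot_mulmx trmxK !dotE hM (dotC (x *m M) q); ring.
Qed.

Lemma qnormal_affine M c q alpha beta x : c != 0 ->
  (forall h k : V, dot (h *m M) (k *m M) = c * dot h k) ->
  qnormal (c * alpha) ((alpha *: q + beta) *m M^T) x *m M
  = c *: qnormal alpha beta (q + x *m M).
Proof.
move=> c0 hM; rewrite /qnormal mulmxDl (conformal_mxC c0 hM) -scalemxAl.
by move: (x *m M) => y; apply/rowP => j; rewrite !mxE; ring.
Qed.

Lemma dot_qnormal_affine M c q alpha beta x (c0 : c != 0)
  (hM : forall h k : V, dot (h *m M) (k *m M) = c * dot h k)
  (v1 := qnormal (c * alpha) ((alpha *: q + beta) *m M^T) x)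
  (v2 := qnormal alpha beta (q + x *m M)) :
  dot v1 v1 = c * dot v2 v2.
Proof.
apply: (mulfI c0); rewrite -[LHS]hM /v1 (qnormal_affine _ _ _ _ c0 hM) -/v2.
by rewrite dotZl dotZr.
Qed.

Lemma qrefl_affine M c q alpha beta gamma x : c != 0 ->
  (forall h k : V, dot (h *m M) (k *m M) = c * dot h k) ->
  q + qrefl (c * alpha) ((alpha *: q + beta) *m M^T) (quad alpha beta gamma q) x *m M
  = qrefl alpha beta gamma (q + x *m M).
Proof.
move=> c0 hM; rewrite /qrefl mulmxBl -scalemxAl (qnormal_affine _ _ _ _ c0 hM).
rewrite (dot_qnormal_affine _ _ _ _ c0 hM) -(quad_affine _ _ _ _ _ hM) addrA scalerA.
congr (_ - _ *: _); set d := dot _ _.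
(* At a centre both denominators vanish, and [0^-1 = 0] makes both coefficients zero. *)
have [->|d0] := eqVneq d 0; first by rewrite mulr0 invr0 !mulr0 mul0r.
by field; rewrite d0.
Qed.

(** [beta1] is the normal of the pulled back quadric at [0], a point that is mapped to [q]; its
    length is known from the comparison of normals. *)
Lemma disc_affine M c q alpha beta gamma : c != 0 ->
  (forall h k : V, dot (h *m M) (k *m M) = c * dot h k) ->
  let beta1 := (alpha *: q + beta) *m M^T in
  dot beta1 beta1 - (c * alpha) * quad alpha beta gamma q
  = c * (dot beta beta - alpha * gamma).
Proof.
move=> c0 hM /=.
have := dot_qnormal_affine q alpha beta 0 c0 hM.
rewrite /qnormal mul0mx scaler0 add0r addr0 => ->.
by have := dot_qnormal alpha beta gamma q; rewrite /qnormal => ->; ring.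
Qed.

Lemma sinv_dot x : dot (sinv x) (sinv x) = (dot x x)^-1.
Proof.
rewrite /sinv !dotE; have [->|d0] := eqVneq (dot x x) 0; first by rewrite invr0 !mul0r.
by rewrite mulrA -mulrA mulVf// mulr1.
Qed.

(** Inversion exchanges [alpha] and [gamma], so the discriminant is unchanged; hyperplanes are
    exchanged with spheres through [0]. *)
Lemma quad_sinv alpha beta gamma x : x != 0 ->
  quad alpha beta gamma (sinv x) = (dot x x)^-1 * quad gamma beta alpha x.
Proof.
rewrite -dot_eq0 => x0; rewrite /quad sinv_dot /sinv dotZr; by field.
Qed.

(* With s = |x|^2, v1 and v2 the two normals and d the common discriminant,
   |v1|^2 = gamma Q + d, s |v2|^2 = alpha Q + s d and
   |qrefl x|^2 = s |v2|^2 / |v1|^2, where Q = quad gamma beta alpha x. *)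
Lemma qrefl_sinv alpha beta gamma x : x != 0 ->
  qnormal gamma beta x != 0 -> qnormal alpha beta (sinv x) != 0 ->
  qrefl gamma beta alpha x != 0 /\
  sinv (qrefl gamma beta alpha x) = qrefl alpha beta gamma (sinv x).
Proof.
move=> x0 v10 v20; have s0 := x0; rewrite -dot_eq0 in s0.
have V1 := dot_qnormal gamma beta alpha x.
have V2 := dot_qnormal alpha beta gamma (sinv x).
rewrite quad_sinv// in V2.
have [v1 v1E] : exists v, v = qnormal gamma beta x by eexists.
have [v2 v2E] : exists v, v = qnormal alpha beta (sinv x) by eexists.
rewrite -v1E in v10 V1; rewrite -v2E in v20 V2.
rewrite -dot_eq0 in v10; rewrite -dot_eq0 in v20.
set Q := quad gamma beta alpha x in V1 V2.
set d := dot beta beta - alpha * gamma in V2.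
have V1' : dot v1 v1 = gamma * Q + d by rewrite V1 /d; ring.
have V2' : dot x x * dot v2 v2 = alpha * Q + dot x x * d.
  by rewrite V2; field.
have xv : 2 * dot x v1 = Q + gamma * dot x x - alpha.
  by rewrite v1E /qnormal /Q /quad !dotE (dotC x beta); ring.
have N1 : dot (qrefl gamma beta alpha x) (qrefl gamma beta alpha x)
    = dot x x * dot v2 v2 / dot v1 v1.
  rewrite /qrefl -v1E -/Q !dotE (dotC v1 x).
  transitivity (dot x x - Q * (2 * dot x v1) / dot v1 v1 + Q ^+ 2 / dot v1 v1).
    by field.
  rewrite xv V2'.
  transitivity ((dot x x * dot v1 v1 - Q * (Q + gamma * dot x x - alpha) + Q ^+ 2) / dot v1 v1).
    by field.
  by congr (_ / _); rewrite V1'; ring.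
split; first by rewrite -dot_eq0 N1 !mulf_neq0// invr_eq0.
rewrite {1}/sinv N1 /qrefl -v1E -v2E quad_sinv// -/Q.
have -> : (dot x x * dot v2 v2 / dot v1 v1)^-1 *: (x - (Q / dot v1 v1) *: v1)
   = (dot x x * dot v2 v2)^-1 *: (dot v1 v1 *: x - Q *: v1).
  by apply/rowP => j; rewrite !mxE; field; rewrite v10 v20 s0.
have -> : sinv x - ((dot x x)^-1 * Q / dot v2 v2) *: v2
   = (dot x x * dot v2 v2)^-1 *: (dot v2 v2 *: x - Q *: v2).
  rewrite /sinv; by apply/rowP => j; rewrite !mxE; field; rewrite v20 s0.
congr (_ *: _).
have V2'' : dot v2 v2 = alpha * Q / dot x x + d by rewrite V2; field.
rewrite V1' V2'' v1E v2E /qnormal /sinv.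
by apply/rowP => j; rewrite !mxE; field.
Qed.

Lemma exists_orthogonal v : (1 < N)%N -> exists2 t : V, t != 0 & dot v t = 0.
Proof.
move=> N1; pose i0 := Ordinal (ltnW N1); pose i1 := Ordinal N1.
have evn i : ev R i != 0 by rewrite -dot_eq0 dot_evr mxE !eqxx oner_eq0.
have [v0|v0] := eqVneq (v 0 i0) 0; first by exists (ev R i0); rewrite ?dot_evr.
exists (v 0 i1 *: ev R i0 - v 0 i0 *: ev R i1).
  apply/eqP => /rowP /(_ i1); rewrite !mxE !eqxx /=.
  by rewrite mulr0 mulr1 sub0r => /eqP; rewrite oppr_eq0 (negbTE v0).
by rewrite !dotE !dot_evr; ring.
Qed.

(** The values at [e] and [- e] separate the odd and even parts; with [e / 2] each part becomes a
    system of two equations in two unknowns. *)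
Lemma quartic_vanish (a b c d e : R) : 0 < e ->
  (forall s, `|s| <= e -> a * s + b * s ^+ 2 + c * s ^+ 3 + d * s ^+ 4 = 0) ->
  a = 0 /\ b = 0.
Proof.
move=> e0 H.
have h1 := H e; have h2 := H (- e); have h3 := H (e / 2); have h4 := H (- (e / 2)).
have e2 : 0 < e / 2 by rewrite divr_gt0.
move: h1 h2 h3 h4; rewrite !normrN (gtr0_norm e0) (gtr0_norm e2) => h1 h2 h3 h4.
have {}h1 := h1 (lexx _); have {}h2 := h2 (lexx _).
have ee : e / 2 <= e by lra.
have {}h3 := h3 ee; have {}h4 := h4 ee.
have A : a * e = 0 by lra.
have B : b * e ^+ 2 = 0 by lra.
split; first by move/eqP: A; rewrite mulf_eq0 (gt_eqF e0) orbF => /eqP.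
by move/eqP: B; rewrite mulf_eq0 sqrf_eq0 (gt_eqF e0) orbF => /eqP.
Qed.

(* The quadric is parametrised near x0 by
   s |-> x0 + (s t + mu s^2 v) / (1 + nu s^2), for t orthogonal to its normal v. *)
Lemma quad_proportional alpha beta gamma alpha' beta' gamma' (O : set V) x0 :
  (1 < N)%N -> 0 < dot beta beta - alpha * gamma -> open O -> O x0 ->
  quad alpha beta gamma x0 = 0 ->
  (forall x, O x -> quad alpha beta gamma x = 0 -> quad alpha' beta' gamma' x = 0) ->
  exists k : R, [/\ alpha' = k * alpha, beta' = k *: beta & gamma' = k * gamma].
Proof.
move=> N1 disc oO Ox0 qx0 H; have qx0' := H _ Ox0 qx0.
have [v vD] : exists v, v = qnormal alpha beta x0 by eexists.
have [v' v'D] : exists v, v = qnormal alpha' beta' x0 by eexists.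
have vv : 0 < dot v v by rewrite vD (dot_qnormal _ _ gamma) qx0 mulr0 add0r.
have vv0 := lt0r_neq0 vv.
have Qh a b c h : quad a b c (x0 + h) = quad a b c x0 + 2 * dot (qnormal a b x0) h + a * dot h h.
  by rewrite /quad /qnormal !dotE (dotC h x0); ring.
have [e e0 eO] : exists2 e : R, 0 < e & forall h : V, `|h| < e -> O (x0 + h).
  have /nbhs_ballP[e e0 eO] := open_nbhs_nbhs (conj oO Ox0).
  exists e => // h he; apply: eO; rewrite -ball_normE /= opprD addNKr normrN//.
have key t : dot v t = 0 -> dot v' t = 0 /\ - (alpha * dot t t / dot v v) * dot v' v + alpha' * dot t t = 0.
  (* [mu] and [nu] cancel the coefficients of [s^2] and [s^4] in the equation of the quadric along
     the curve. As [nu >= 0], its denominator is at least [1]. *)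
  move=> vt; pose mu := - (alpha * dot t t / (2 * dot v v)).
  pose nu := alpha ^+ 2 * dot t t / (4 * dot v v).
  have nu0 : 0 <= nu by apply: divr_ge0; apply: mulr_ge0; rewrite ?sqr_ge0 ?dot_ge0 ?ler0n.
  pose C := `|t| + `|mu| * `|v| + 1.
  have C0 : 0 < C by rewrite ltr_wpDl// addr_ge0// mulr_ge0.
  (* [|s| <= 1] bounds [s^2] by [|s|], so the numerator has norm at most [C |s| <= e / 2]. *)
  pose e1 := Num.min 1 (e / (2 * C)).
  have e10 : 0 < e1 by rewrite lt_min ltr01 divr_gt0// mulr_gt0.
  have P s : `|s| <= e1 -> (2 * dot v' t) * s + (2 * mu * dot v' v + alpha' * dot t t) * s ^+ 2
     + (2 * nu * dot v' t) * s ^+ 3 + (2 * mu * nu * dot v' v + alpha' * mu ^+ 2 * dot v v) * s ^+ 4 = 0.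
    rewrite le_min => /andP[s1 sC].
    pose m := 1 + nu * s ^+ 2.
    have m1 : 1 <= m by rewrite lerDl mulr_ge0// sqr_ge0.
    have m0 : m != 0 by rewrite gt_eqF// (lt_le_trans ltr01).
    pose u := s *: t + (mu * s ^+ 2) *: v.
    have uC : `|m^-1 *: u| < e.
      have mV : `|m^-1| <= 1.
        by rewrite ger0_norm ?invr_ge0 ?(le_trans ler01)// invf_le1// (lt_le_trans ltr01).
      rewrite normrZ (le_lt_trans (y := `|u|))//; first by rewrite ler_piMl.
      rewrite /u (le_lt_trans (ler_normD _ _))// !normrZ.
      have s2 : `|s| * `|s| <= `|s| by rewrite ler_piMl.
      have : `|mu| * (`|s| * `|s|) * `|v| <= `|mu| * `|s| * `|v|.
        by rewrite ler_wpM2r// ler_wpM2l.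
      move: sC; rewrite ler_pdivlMr ?mulr_gt0// /C => sC.
      by have := normr_ge0 s; lra.
    have vu : dot v u = mu * s ^+ 2 * dot v v by rewrite /u !dotE vt; ring.
    have uu : dot u u = s ^+ 2 * dot t t + mu ^+ 2 * s ^+ 4 * dot v v.
      by rewrite /u !dotE vt (dotC t v) vt; ring.
    have Z : quad alpha beta gamma (x0 + m^-1 *: u) = 0.
      rewrite Qh qx0 add0r -vD !dotZr dotZl vu uu.
      rewrite /m /mu /nu; field; rewrite vv0 /=.
      have : 0 < 4 * dot v v + alpha ^+ 2 * dot t t * s ^+ 2.
        by have := mulr_ge0 (mulr_ge0 (sqr_ge0 alpha) (dot_ge0 t)) (sqr_ge0 s); lra.
      by move/lt0r_neq0.
    have := H _ (eO _ uC) Z; rewrite Qh qx0' add0r -v'D !dotZr dotZl uu => Z'.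
    have v'u : dot v' u = s * dot v' t + mu * s ^+ 2 * dot v' v by rewrite /u !dotE.
    have {Z'} : m ^+ 2 * (2 * (m^-1 * dot v' u) + alpha' * (m^-1 * (m^-1 *
        (s ^+ 2 * dot t t + mu ^+ 2 * s ^+ 4 * dot v v)))) = 0 by rewrite Z' mulr0.
    have -> : m ^+ 2 * (2 * (m^-1 * dot v' u) + alpha' * (m^-1 * (m^-1 *
        (s ^+ 2 * dot t t + mu ^+ 2 * s ^+ 4 * dot v v)))) =
       2 * m * dot v' u + alpha' * (s ^+ 2 * dot t t + mu ^+ 2 * s ^+ 4 * dot v v).
      by field.
    by rewrite v'u /m => <-; ring.
  have [A B] := quartic_vanish e10 P; split; first by lra.
  by rewrite -B /mu; field.
pose k := dot v' v / dot v v.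
(* The part of [v'] orthogonal to [v] is a tangent direction, so [key] makes it orthogonal to [v']
   as well, hence zero. *)
have v'E : v' = k *: v.
  have O1 : dot v (v' - k *: v) = 0.
    by rewrite !dotE (dotC v v') /k mulfVK// subrr.
  have [A _] := key _ O1.
  by apply/eqP; rewrite -subr_eq0 -dot_eq0 dotBl dotZl A O1 mulr0 subrr.
have [t t0 vt] := exists_orthogonal v N1.
(* The second-order condition in a single nonzero tangent direction compares the quadratic
   coefficients. *)
have [_ B] := key t vt.
have tt : dot t t != 0 by rewrite dot_eq0.
have aE : alpha' = k * alpha.
  apply: (mulIf tt); have := B; rewrite v'E dotZl => /eqP.
  rewrite addrC addr_eq0 => /eqP ->; by field.
have bE : beta' = k *: beta.
  have : beta' = v' - alpha' *: x0 by rewrite v'D /qnormal addrC addKr.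
  by rewrite v'E aE vD /qnormal scalerDr scalerA addrC addKr.
exists k; split => //.
move: qx0 qx0'; rewrite /quad aE bE dotZl => q1 q2.
have -> : gamma' = - (k * alpha * dot x0 x0 + 2 * (k * dot beta x0)) by lra.
have -> : gamma = - (alpha * dot x0 x0 + 2 * dot beta x0) by lra.
ring.
Qed.

End Quadrics.

(** * Directions and arguments *)

Section Exponential.
Variables (R : realType) (n : nat) (hn : composition R n).
Notation K := (cd R n).
Implicit Types (I z : K) (t : R).

(** Because [I^2 = -1], the powers stay in the span of [1] and [I]. The coefficients have the form
    of those of cosine and sine; the predecessor in [k.-1./2] matters only for odd [k]. *)
Lemma cdexpn_imaginary I t k : cdre I = 0 -> dot I I = 1 ->
  cdexpn (t *: I) k = ((~~ odd k)%:R * (-1) ^+ k./2 * t ^+ k) *: cdone R n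
    + ((odd k)%:R * (-1) ^+ k.-1./2 * t ^+ k) *: I.
Proof.
move=> I0 I1.
have II : cdmul I I = - cdone R n.
  have := cdmulK_conj hn I (cdone R n); rewrite cdmul1l I1 scale1r cdconjE I0.
  by rewrite mulr0 scale0r sub0r cdmulNr => <-; rewrite opprK.
rewrite /cdexpn; elim: k => [|k IH]; first by rewrite /= !expr0 !mulr1 mulr0n scale1r scale0r addr0.
rewrite iterS IH cdmulDr !cdmulZr !cdmulZl cdmul1r II.
have [m [->|->]] : exists m, k = m.*2 \/ k = m.*2.+1.
  exists k./2; rewrite -{1 3}(odd_double_half k).
  by case: odd; [right|left].
- rewrite /= !odd_double /= ?doubleK ?uphalf_double ?doubleK.
  by apply/rowP => j; rewrite !mxE exprS; ring.
- rewrite /= !odd_double /= ?negbK ?doubleK ?uphalf_double ?doubleK.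
  by apply/rowP => j; rewrite !mxE !exprS; ring.
Qed.

Lemma cdexp_imaginary I t : cdre I = 0 -> dot I I = 1 ->
  cdexp (t *: I) = cos t *: cdone R n + sin t *: I.
Proof.
move=> I0 I1; apply: cvg_lim; first exact: norm_hausdorff.
apply: coord_cvg => i.
rewrite (_ : (fun m => _) = series (cdone R n 0 i *: cos_coeff t + I 0 i *: sin_coeff t)); last first.
  apply/funext => m; rewrite series_coord; congr (series _ m); apply/funext => k.
  rewrite cdexpn_imaginary// cos_coeffE sin_coeffE !fctE !mxE /GRing.scale /=; ring.
have H (c : R) (f : R^nat) : cvgn (series f) ->
    (c *: series f) @ \oo --> limn (series f) * c.
  by move=> cf; rewrite mulrC; apply: cvgM; [exact: cvg_cst|exact: cf].
rewrite seriesD !seriesZ !mxE cos.unlock sin.unlock.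
by apply: cvgD; apply: H; [exact: is_cvg_series_cos_coeff|exact: is_cvg_series_sin_coeff].
Qed.

(** Polar form: the axis is the normalised imaginary part of [z], the angle the arccosine of the
    normalised real part. A real [z] has no axis of its own, and [I0] serves instead. *)
Lemma cdArg_exists z : (exists2 I : K, cdre I = 0 & dot I I = 1) -> z != 0 ->
  exists M, cdArg z M.
Proof.
move=> [I0 I0re I01] z0; have az : 0 < cdabs z by rewrite cdabs_gt0.
have [u uE] : exists u, u = (cdabs z)^-1 *: z by eexists.
pose a := cdre u; pose w := u - a *: cdone R n.
have zu : z = cdabs z *: u by rewrite uE scalerA mulfV ?gt_eqF// scale1r.
have uu : dot u u = 1.
  by rewrite uE dotZl dotZr -cdabs_sqr; field; rewrite gt_eqF.
have aE : dot u (cdone R n) = a by rewrite -cdre_dot1.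
have ww : dot w w = 1 - a ^+ 2.
  by rewrite /w dotBl !dotBr !dotZl !dotZr uu dot11 (dotC _ u) aE; ring.
have wre : cdre w = 0.
  by rewrite cdre_dot1 /w dotBl dotZl dot11 aE mulr1 subrr.
have a1 : -1 <= a <= 1.
  have := dot_ge0 w; rewrite ww subr_ge0 => h.
  by rewrite -ler_norml -(ler_sqr (x := `|a|)) ?nnegrE// expr1n real_normK ?num_real.
have [I [Ire I1 wE]] : exists I, [/\ cdre I = 0, dot I I = 1 & w = Num.sqrt (1 - a ^+ 2) *: I].
  have [w0|w0] := eqVneq w 0.
    by exists I0; split => //; rewrite -ww w0 dot0l sqrtr0 scale0r.
  have aw : cdabs w != 0 by rewrite cdabs_eq0.
  exists ((cdabs w)^-1 *: w); split.
  - by rewrite cdreZ wre mulr0.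
  - by rewrite dotZl dotZr -cdabs_sqr; field.
  - by rewrite -ww -cdabsE scalerA mulfV// scale1r.
exists (acos a *: I); split; first by rewrite cdreZ Ire mulr0.
rewrite {1}zu cdexp_imaginary// acosK ?in_itv//= sin_acos// -wE.
by rewrite /w addrC subrK.
Qed.

(** Equality of the two sets of arguments is exploited through a common value, which exists because
    the set at [z1] is nonempty. *)
Lemma cdArg_same_direction z1 z2 : (exists2 I : K, cdre I = 0 & dot I I = 1) ->
  z1 != 0 -> cdArg z2 = cdArg z1 -> z2 = (cdabs z2 / cdabs z1) *: z1.
Proof.
move=> hI z0 E; have [M M1] := cdArg_exists hI z0.
have M2 : cdArg z2 M by rewrite E.
have [_ e1] := M1; have [_ e2] := M2.
by rewrite {2}e1 scalerA mulfVK ?cdabs_eq0// -e2.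
Qed.

End Exponential.

Lemma imaginary_unit (R : realType) n : (0 < n)%N ->
  exists2 I : cd R n, cdre I = 0 & dot I I = 1.
Proof.
case: n => // n _; exists (cdpair 0 (cdone R n)).
  by rewrite /= cdl_pair cdre0.
by rewrite dot_pair dot0l add0r dot11.
Qed.

Section Mirrors.
Variables (R : realType) (n : nat) (hn : composition R n) (n0 : (0 < n)%N).
Notation K := (cd R n).

(** For a hyperplane [beta] is its normal [b] and [alpha = 0]; for a hypersphere [alpha = 1] and
    [beta] is minus the centre. A centre has no symmetrical point, since the product of distances
    would be [0] instead of [r^2]. *)
Lemma mirror_quad (S : mirror R n) : mirror_ok S ->
  exists (alpha : R) (beta : K) (gamma : R),
  [/\ 0 < dot beta beta - alpha * gamma,
      forall x, mirror_set S x <-> quad alpha beta gamma x = 0 &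
      forall x y, symmetrical S x y ->
        qnormal alpha beta x != 0 /\ y = qrefl alpha beta gamma x].
Proof.
case: S => [b c|z0 r] /= ok.
  have bb : dot b b != 0 by rewrite dot_eq0.
  exists 0, b, (- 2 * c); split.
  - by rewrite mul0r subr0 dot_gt0.
  - by move=> x; rewrite cdre_dot /quad (dotC b x); split; lra.
  - move=> x y [[t xy]]; rewrite cdre_dot dotZl dotDl => H.
    have yE : y = x + t *: b by rewrite -xy subrKC.
    rewrite /qrefl /qnormal scale0r add0r; split => //.
    rewrite yE -scaleNr; congr (_ + _ *: _).
    suff T : t * dot b b = - quad 0 b (- 2 * c) x by rewrite -mulNr -T mulfK.
    by move: H; rewrite yE dotDl dotZl /quad (dotC b x); lra.
have r0 : r != 0 by rewrite gt_eqF.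
have E x : quad 1 (- z0) (dot z0 z0 - r ^+ 2) x = dot (x - z0) (x - z0) - r ^+ 2.
  by rewrite /quad !dotE (dotC z0 x); ring.
exists 1, (- z0), (dot z0 z0 - r ^+ 2); split.
- by rewrite dotNl dotNr opprK mul1r opprB addrC subrK exprn_gt0.
- move=> x; rewrite E -cdabs_sqr; split => [->|]; first by rewrite subrr.
  move/eqP; rewrite subr_eq0 => /eqP; move: ok => /ltW ok.
  by move/(pexpIrn (isT : (0 < 2)%N)); apply; rewrite nnegrE ?cdabs_ge0.
- move=> x y [xy A]; rewrite /qrefl /qnormal scale1r E.
  have x0 : x - z0 != 0.
    apply/eqP => x0; move: xy; rewrite x0 cdabs0 mul0r => /esym/eqP.
    by rewrite expf_eq0 (negbTE r0).
  split => //; have H := cdArg_same_direction hn (imaginary_unit R n0) x0 A.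
  have ax : cdabs (x - z0) != 0 by rewrite cdabs_eq0.
  have aE : cdabs (y - z0) = r ^+ 2 / cdabs (x - z0) by rewrite -xy; field.
  rewrite -[LHS](subrKC z0) H aE -cdabs_sqr.
  move: (cdabs (x - z0)) ax => a ax.
  by apply/rowP => j; rewrite !mxE; field.
Qed.

End Mirrors.

(** * The extension *)

Section Limits.
Variables (R : realType) (n : nat).
Notation K := (cd R n).

Lemma cvg_dot (T : Type) (F : set_system T) (u v : T -> K) (a b : K) : Filter F ->
  u x @[x --> F] --> a -> v x @[x --> F] --> b ->
  dot (u x) (v x) @[x --> F] --> dot a b.
Proof.
move=> FF ua vb; apply: cvg_big => [|i _]; first exact: add_continuous.
by apply: cvgM; exact: cvg_coord.
Qed.

Lemma cvg_sinv (T : Type) (F : set_system T) (u : T -> K) (a : K) : Filter F -> a != 0 ->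
  u x @[x --> F] --> a -> sinv (u x) @[x --> F] --> sinv a.
Proof.
move=> FF a0 ua; apply: cvgZ => //; apply: cvgV; last exact: cvg_dot.
by rewrite dot_eq0.
Qed.

Lemma within_proper (U : set K) (zeta : K) : closure U zeta ->
  ProperFilter (within U (nbhs zeta)).
Proof.
move=> cU; apply: Build_ProperFilter_ex => P; rewrite /within /= => PU.
by have [x [Ux PUx]] := cU _ PU; exists x; exact: PUx.
Qed.

Lemma within_eq_cvg (T : topologicalType) (U : set K) (f g : K -> T) (zeta : K) (l : T) :
  (forall x, U x -> f x = g x) -> g @ within U (nbhs zeta) --> l ->
  f @ within U (nbhs zeta) --> l.
Proof.
move=> fg gl P /gl; rewrite /nbhs /= /within /=.
by apply: filterS => x H Ux; rewrite /= fg//; exact: H.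
Qed.

Lemma cvg_within_eq (U : set K) (f g : K -> K) (zeta a b : K) : closure U zeta ->
  (forall x, U x -> f x = g x) -> f @ within U (nbhs zeta) --> a ->
  g @ within U (nbhs zeta) --> b -> a = b.
Proof.
move=> /within_proper PU fg fa gb.
exact: (cvg_unique _ fa (within_eq_cvg fg gb)).
Qed.

(** On [U] the product [|f - q|^2 |x - p|^2] is the constant [c > 0], whereas it would tend to [0]
    at a pole where [f] has a finite limit. *)
Lemma no_pole (U : set K) (f : K -> K) (q p l zeta : K) (M : 'M[R]_(cdim n)) :
  conformal_mx M -> closure U zeta ->
  (forall x, U x -> x != p /\ f x = q + sinv (x - p) *m M) ->
  f @ within U (nbhs zeta) --> l -> zeta != p.
Proof.
move=> [c c0 cM] cU fE fl; apply/eqP => zp.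
have PU := within_proper cU.
have idz : (fun x : K => x) @ within U (nbhs zeta) --> zeta.
  exact: cvg_within.
have H1 : (fun x => dot (f x - q) (f x - q) * dot (x - p) (x - p)) @ within U (nbhs zeta)
    --> dot (l - q) (l - q) * dot (zeta - p) (zeta - p).
  by apply: cvgM; apply: cvg_dot; apply: cvgB => //; exact: cvg_cst.
have H2 : (fun x => dot (f x - q) (f x - q) * dot (x - p) (x - p)) @ within U (nbhs zeta) --> c.
  apply: within_eq_cvg (cvg_cst c) => x /fE[xp ->].
  by rewrite addrC addKr cM sinv_dot mulfVK// dot_eq0 subr_eq0.
have E : dot (l - q) (l - q) * dot (zeta - p) (zeta - p) = c.
  exact: (cvg_unique _ H1 H2).
by move: c0; rewrite -E zp subrr dot0l mulr0 ltxx.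
Qed.

End Limits.

Section Reflection.
Variables (R : realType) (n : nat) (hn : composition R n) (dim2 : (2 < cdim n)%N).
Notation K := (cd R n).

(* F is the Moebius map equal to f on U, G the complement of its pole, and
   alpha1, beta1, gamma1 the equation of the preimage of the given quadric. *)
Lemma moebius_extension (U : set K) (f : K -> K) (D : K -> K -> K) (V : set K)
  (alpha gamma : R) (beta : K) :
  open U -> connected U -> U !=set0 -> pseudoconformal_on f D U ->
  V `<=` closure U ->
  (forall zeta, V zeta -> f @ within U (nbhs zeta) --> f zeta) ->
  0 < dot beta beta - alpha * gamma ->
  exists (F : K -> K) (DF : K -> K -> K) (G : set K) (alpha1 : R) (beta1 : K) (gamma1 : R),
  [/\ forall x, (U `|` V) x -> G x /\ F x = f x,
      forall x, G x -> pseudoconformal_at F x (DF x),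
      0 < dot beta1 beta1 - alpha1 * gamma1,
      forall x, G x -> quad alpha beta gamma (F x) = 0 -> quad alpha1 beta1 gamma1 x = 0 &
      forall x, G x -> qnormal alpha1 beta1 x != 0 -> qnormal alpha beta (F x) != 0 ->
        G (qrefl alpha1 beta1 gamma1 x) /\
        F (qrefl alpha1 beta1 gamma1 x) = qrefl alpha beta gamma (F x)].
Proof.
move=> oU cU U0 fD VU fV disc.
have [x0 Ux0] := U0; have [_ _ _ det0] := fD x0 Ux0.
have [q [M [cM [ME|[p ME]]]]] := pseudoconformal_liouville hn dim2 oU cU U0 fD.
- have detM : 0 < \det M.
    by rewrite -(lin1_mxE (ME x0 Ux0).2).
  have [c c0 hM] := cM; have cn0 := lt0r_neq0 c0.
  exists (fun x => q + x *m M), (fun _ h => h *m M), setT,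
    (c * alpha), ((alpha *: q + beta) *m M^T), (quad alpha beta gamma q); split.
  + move=> x [Ux|Vx]; split => //; first by have [-> _] := ME x Ux.
    apply/esym; apply: (cvg_within_eq (VU x Vx) _ (fV x Vx)).
      by move=> y Uy; have [-> _] := ME y Uy.
    apply: cvgD; first exact: cvg_cst.
    apply: (cvg_lin _ (g := fun x => x *m M)).
      by move=> a u v; rewrite mulmxDl scalemxAl.
    exact: cvg_within.
  + by move=> x _; exact: affine_pseudoconformal.
  + by rewrite disc_affine// mulr_gt0.
  + by move=> x _; rewrite -quad_affine.
  + by move=> x _ _ _; split => //; exact: qrefl_affine.
(* The derivative of the inversion has negative determinant and [D x0] a positive one, which fixes
   the sign of the remaining factor. *)
- have detM : \det M < 0.
    have [xp _ DE] := ME x0 Ux0.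
    rewrite -(inversive_det M xp); move: det0.
    by congr (0 < \det (lin1_mx _)); apply/funext.
  have [c c0 hM] := cM; have cn0 := lt0r_neq0 c0.
  (* The translation by [- p] is viewed as a similarity with identity matrix, so that the affine
     lemmas apply to it. *)
  have h1 (h k : K) : dot (h *m 1%:M) (k *m 1%:M) = 1 * dot h k by rewrite !mulmx1 mul1r.
  have tr (x : K) : x - p = - p + x *m 1%:M by rewrite mulmx1 addrC.
  have one0 : (1 : R) != 0 by exact: oner_neq0.
  (* The quadric is pulled back in three stages: through the similarity, giving [a'], [b'], [g'];
     through the inversion, which swaps [a'] and [g']; and through the translation. *)
  pose a' := c * alpha; pose b' := (alpha *: q + beta) *m M^T; pose g' := quad alpha beta gamma q.
  have disc' : 0 < dot b' b' - g' * a'.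
    by rewrite (mulrC g') disc_affine// mulr_gt0.
  exists (fun x => q + sinv (x - p) *m M), (fun x h => dsinv (x - p) h *m M), [set x | x != p],
    (1 * g'), ((g' *: (- p) + b') *m 1%:M^T), (quad g' b' a' (- p)); split.
  + move=> x [Ux|Vx]; first by have [xp -> _] := ME x Ux.
    have xp : x != p.
      apply: (no_pole cM (VU x Vx) _ (fV x Vx) (q := q)) => y Uy.
      by have [yp -> _] := ME y Uy.
    split => //; apply/esym; apply: (cvg_within_eq (VU x Vx) _ (fV x Vx)).
      by move=> y Uy; have [_ -> _] := ME y Uy.
    apply: cvgD; first exact: cvg_cst.
    apply: (cvg_lin _ (g := fun x => x *m M)).
      by move=> a u v; rewrite mulmxDl scalemxAl.
    apply: cvg_sinv; first by rewrite subr_eq0.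
    by apply: cvgB; [exact: cvg_within|exact: cvg_cst].
  + by move=> x xp; exact: inversive_pseudoconformal.
  + by rewrite disc_affine// mul1r.
  + move=> x xp; rewrite -quad_affine// -tr (quad_affine _ _ _ _ _ hM) quad_sinv ?subr_eq0//.
    move/eqP; rewrite mulf_eq0 invr_eq0 dot_eq0 subr_eq0 (negbTE xp) => /eqP.
    by [].
  + move=> x xp v1 v2.
    have y0 : x - p != 0 by rewrite subr_eq0.
    have w1 : qnormal g' b' (x - p) != 0.
      move: v1; rewrite -!dot_eq0 (dot_qnormal_affine _ _ _ _ one0 h1) mul1r.
      by rewrite -tr.
    have w2 : qnormal a' b' (sinv (x - p)) != 0.
      move: v2; rewrite -!dot_eq0 (dot_qnormal_affine _ _ _ _ cn0 hM).
      by move=> v2; rewrite mulf_neq0.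
    have [z0 zE] := qrefl_sinv y0 w1 w2.
    have rE : qrefl (1 * g') ((g' *: - p + b') *m 1%:M^T) (quad g' b' a' (- p)) x - p
       = qrefl g' b' a' (x - p).
      by rewrite tr (qrefl_affine _ _ _ _ _ one0 h1) -tr.
    split; first by rewrite /= -subr_eq0 rE.
    by rewrite rE zE (qrefl_affine _ _ _ _ _ cn0 hM).
Qed.

End Reflection.

Theorem theorem39 (R : realType) (r : nat) (hr : r = 2%N \/ r = 3%N)
  (U1 U2 V1 V2 W1 W2 : set (cd R r)) (S1 S2 : mirror R r)
  (hU1 : Jordan_domain U1) (hU2 : Jordan_domain U2)
  (hS1 : mirror_ok S1) (hS2 : mirror_ok S2)
  (hV1 : domain_in S1 V1) (hV2 : domain_in S2 V2)
  (hUV1 : V1 `<=` frontier U1) (hUV2 : V2 `<=` frontier U2)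
  (hW1 : Jordan_domain W1) (hW2 : Jordan_domain W2)
  (hUW1 : symmetrical_domains S1 U1 W1) (hUW2 : symmetrical_domains S2 U2 W2)
  (hdisj1 : U1 `&` W1 = set0) (hdisj2 : U2 `&` W2 = set0)
  (f1 : cd R r -> cd R r) (D1 : cd R r -> cd R r -> cd R r)
  (hf1 : pseudoconformal_on f1 D1 U1)
  (hf1U : f1 @` U1 = U2)
  (hf1ext : forall zeta, V1 zeta -> f1 @ within U1 (nbhs zeta) --> f1 zeta)
  (hf1V : f1 @` V1 = V2)
  (hlim : forall zeta, V1 zeta -> exists L : cd R r -> cd R r,
     (exists h, L h != 0) /\
     forall h, D1 z h @[z --> within U1 (nbhs zeta)] --> L h) :
  exists (f : cd R r -> cd R r) (D : cd R r -> cd R r -> cd R r),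
    [/\ forall z, (U1 `|` V1) z -> f z = f1 z,
        pseudoconformal_on f D (U1 `|` V1 `|` W1) &
        f @` (U1 `|` V1 `|` W1) = U2 `|` V2 `|` W2].
Proof.
have hn : composition R r by apply: composition_le3; case: hr => ->.
have dim2 : (2 < cdim r)%N by case: hr => ->.
have r0 : (0 < r)%N by case: hr => ->.
have [oU cU U0 _] := hU1.
have [a1 [b1 [c1 [disc1 S1E sym1]]]] := mirror_quad hn r0 hS1.
have [a2 [b2 [c2 [disc2 S2E sym2]]]] := mirror_quad hn r0 hS2.
have VU : V1 `<=` closure U1 by move=> z /hUV1[].
have [F [DF [G [a [b [c [FE FG disc pull equi]]]]]]] :=
  moebius_extension hn dim2 oU cU U0 hf1 VU hf1ext disc2.
have [[Q oO V1O] _ [x0 V1x0]] := hV1.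
have inV x : Q x -> quad a1 b1 c1 x = 0 -> V1 x.
  by move=> Ox qx; rewrite V1O; split => //; apply/S1E.
have V1q x : V1 x -> Q x /\ quad a1 b1 c1 x = 0.
  by rewrite V1O => -[Ox /S1E].
have [Ox0 qx0] := V1q x0 V1x0.
have [|k [aE bE cE]] := quad_proportional (alpha' := a) (beta' := b) (gamma' := c)
    (ltnW dim2) disc1 oO Ox0 qx0.
  move=> x Ox /(inV x Ox) V1x; have [Gx Fx] := FE x (or_intror V1x).
  apply: pull => //; rewrite Fx; apply/S2E.
  have [[Q2 _ V2O] _ _] := hV2.
  have : V2 (f1 x) by rewrite -hf1V; exists x.
  by rewrite V2O => -[].
(* The pulled back quadric has positive discriminant, so its equation is not identically zero. *)
have k0 : k != 0.
  apply/eqP => k0; move: disc; rewrite aE bE cE k0.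
  by rewrite scale0r dot0l !mul0r subr0 ltxx.
(* [sym1] and [sym2] say that neither [u] nor its image is the centre of its mirror. These are the
   two conditions under which [equi] keeps the reflected point off the pole. *)
have reflect u w u2 w2 : U1 u -> symmetrical S1 u w -> u2 = f1 u -> symmetrical S2 u2 w2 ->
    G w /\ F w = w2.
  move=> Uu /sym1[n1 ->] -> /sym2[n2 ->].
  have [Gu <-] := FE u (or_introl Uu).
  rewrite -(FE u (or_introl Uu)).2 in n2.
  rewrite -(qreflZ _ _ _ _ k0) -aE -bE -cE; apply: equi => //.
  by rewrite /qnormal aE bE -scalerA -scalerDr scaler_eq0 negb_or k0.
have W1F w : W1 w -> G w /\ W2 (F w).
  move=> /hUW1.2[u Uu uw].
  have [w2 W2w2 uw2] : exists2 w2, W2 w2 & symmetrical S2 (f1 u) w2.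
    by apply: hUW2.1; rewrite -hf1U; exists u.
  by have [Gw ->] := reflect _ _ _ _ Uu uw erefl uw2.
exists F, DF; split.
- by move=> z /FE[].
- move=> z [/FE[Gz _]|/W1F[Gz _]]; exact: FG.
- apply/seteqP; split => [_ [z Hz <-]|y].
    case: Hz => [Hz|/W1F[_]]; last by right.
    left; rewrite (FE z Hz).2; case: Hz => Hz; [left|right].
      by rewrite -hf1U; exists z.
    by rewrite -hf1V; exists z.
  case=> [ [ | ] | ].
  + rewrite -hf1U => -[z Uz <-]; exists z; first by left; left.
    exact: (FE z (or_introl Uz)).2.
  + rewrite -hf1V => -[z Vz <-]; exists z; first by left; right.
    exact: (FE z (or_intror Vz)).2.
  + move=> W2y; have [u2 U2u2 u2y] := hUW2.2 _ W2y.
    move: (U2u2); rewrite -hf1U => -[u Uu uu2].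
    have [w W1w uw] := hUW1.1 _ Uu.
    exists w; first by right.
    exact: (reflect _ _ _ _ Uu uw (esym uu2) u2y).2.
Qed.
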